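(* Let $U$ be a subspace of $W$ with $\dim U=d$ (so $d\le k\le n$). Let $\mathcal{I}=(p_1,\ldots,p_k)$ be a $k$-tuple of invariant factors with $\deg\prod_{i=1}^k p_i=d$. Then $$N(V,W,U;\mathcal{I})=\frac{|\mathrm{GL}_d(\mathbb{F}_q)|}{\prod_{f\in S(\mathcal{I})}c_f(\Phi_{\mathcal{I}}(f))}\prod_{i=d+1}^{k}(q^n-q^i),$$ where $N(V,W,U;\mathcal{I})=\#\{T\in L(W,V):\mathfrak{I}(T)=U\text{ and }\mathcal{I}_T=\mathcal{I}\}$ (with the conventions $|\mathrm{GL}_0(\mathbb{F}_q)|=1$ and empty products equal to $1$).
   Context: Let $\mathbb{F}_q$ be the finite field with $q$ elements and let $n\ge k$ be positive integers. Let $V$ be an $n$-dimensional $\mathbb{F}_q$-vector space and $W\subseteq V$ a $k$-dimensional subspace. Fix an ordered basis $\mathcal{B}_1=(v_1,\ldots,v_k)$ of $W$ and extend it to an ordered basis $\mathcal{B}_2=(v_1,\ldots,v_n)$ of $V$. $L(W,V)$ denotes the space of $\mathbb{F}_q$-linear maps $W\to V$. $I_{n,k}\in M_{n,k}(\mathbb{F}_q)$ is the matrix whose $(i,j)$ entry is $1$ if $i=j$ and $0$ otherwise. For a nonzero polynomial matrix $A\in M_{n,k}(\mathbb{F}_q[x])$, its $i$-th determinantal divisor $\delta_i(A)$ is the monic gcd of all $i\times i$ minors of $A$ (with $\delta_0=1$), and its invariant factors are the monic polynomials $p_i=\delta_i(A)/\delta_{i-1}(A)$; they are the diagonal entries of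 the Smith normal form of $A$. For $T\in L(W,V)$ with matrix $B\in M_{n,k}(\mathbb{F}_q)$ with respect to $\mathcal{B}_1,\mathcal{B}_2$, the matrix $xI_{n,k}-B$ has exactly $k$ invariant factors $p_1\mid\cdots\mid p_k$, called the invariant factors of $T$; write $\mathcal{I}_T=(p_1,\ldots,p_k)$. A $k$-tuple of invariant factors is a tuple $(p_1,\ldots,p_k)$ of monic polynomials in $\mathbb{F}_q[x]$ with $p_i\mid p_{i+1}$ for $1\le i<k$. $\mathfrak{I}(T)$ denotes the maximal $T$-invariant subspace contained in $W$ (the largest subspace $U\subseteq W$ with $T(U)\subseteq U$). Partition notation: for a partition $\lambda$ with conjugate $\lambda'=(\lambda_1',\lambda_2',\ldots)$, let $m_i=\lambda_i'-\lambda_{i+1}'$ (number of parts equal to $i$) and $h_i=\lambda_1'+\cdots+\lambda_i'$. For an irreducible $f\in\mathbb{F}_q[x]$ of degree $\deg f=e$, set $c_f(\lambda)=\prod_{i\ge1}\prod_{j=1}^{m_i}\left(q^{e h_i}-q^{e(h_i-j)}\right)$. For irreducible $f$ and nonzero $g$, $\nu_f(g)=\max\{e: f^e\mid g\}$. For $\mathcal{I}=(p_1,\ldots,p_k)$ with $P=\prod p_i$, $S(\mathcal{I})$ is the set of monic irreducible divisors of $P$, and for $f\in S(\mathcal{I})$, $\Phi_{\mathcal{I}}(f)$ is the partition $(\nu_f(p_k),\nu_f(p_{k-1}),\ldots,\nu_f(p_r))$ of $\nu_f(P)$, where $r=\min\{i:\nu_f(p_i)>0\}$. *)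

(* Defs.v *)
From HB Require Import structures.
From mathcomp Require Import all_boot all_order all_fingroup all_algebra.
From Stdlib Require Import ClassicalEpsilon.
Set Implicit Arguments. Unset Strict Implicit. Unset Printing Implicit Defensive.
Import Order.TTheory GRing.Theory Num.Theory.
Local Open Scope ring_scope.

(* Boolean reflection of a Prop (classical), used to filter by the library's
   Prop-valued [irreducible_poly]. *)
Definition pbool (P : Prop) : bool :=
  if excluded_middle_informative P then true else false.

Section Defs.
Variable F : finFieldType.

Definition Imx (R : pzRingType) (n k : nat) : 'M[R]_(n, k) :=
  \matrix_(i < n, j < k) (if (i : nat) == j then 1 else 0).

(* x I_{n,k} - B, for B the matrix of T w.r.t. B1, B2. *)
Definition charmx (n k : nat) (B : 'M[F]_(n, k)) : 'M[{poly F}]_(n, k) :=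
  'X *: Imx {poly F} n k - map_mx polyC B.

Definition incr (i m : nat) (f : {ffun 'I_i -> 'I_m}) : bool :=
  [forall a : 'I_i, forall b : 'I_i, (a < b)%N ==> (f a < f b)%N].

(* monic normalisation of a polynomial (0 stays 0) *)
Definition monicize (p : {poly F}) : {poly F} := (lead_coef p)^-1 *: p.

Definition detdiv (n k : nat) (A : 'M[{poly F}]_(n, k)) (i : nat) : {poly F} :=
  monicize (\big[@gcdp F/0]_(r : {ffun 'I_i -> 'I_n} | incr r)
              \big[@gcdp F/0]_(c : {ffun 'I_i -> 'I_k} | incr c)
                 \det (\matrix_(a < i, b < i) A (r a) (c b))).

(* invariant factors of T (matrix B): p_{i+1} = delta_{i+1} / delta_i,
   indexed by i : 'I_k (i.e. p_1, ..., p_k) *)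
Definition inv_factor (n k : nat) (B : 'M[F]_(n, k)) (i : 'I_k) : {poly F} :=
  detdiv (charmx B) i.+1 %/ detdiv (charmx B) i.

(* Coordinates: a vector of W is a row u : 'rV_k (coordinates in B1), a vector
   of V is a row in 'rV_n (coordinates in B2); W embeds via u |-> u *m I_{n,k}^T
   and T acts via u |-> u *m B^T.  A subspace of W is the row space of X : 'M_k. *)
Definition T_invariant (n k : nat) (B : 'M[F]_(n, k)) (X : 'M[F]_k) : bool :=
  (X *m B^T <= X *m (Imx F n k)^T)%MS.

Definition is_max_inv (n k : nat) (B : 'M[F]_(n, k)) (U : 'M[F]_k) : bool :=
  T_invariant B U && [forall X : 'M[F]_k, T_invariant B X ==> (X <= U)%MS].

Definition GLcard (d : nat) : nat := if d is 0%N then 1%N else #|('GL_d[F])%g|.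

Definition nu (f g : {poly F}) : nat := \max_(e < size g | (f ^+ e %| g)%R) (e : nat).

Definition conjp (la : seq nat) (i : nat) : nat := count (fun x => i <= x)%N la.
Definition mpart (la : seq nat) (i : nat) : nat := (conjp la i - conjp la i.+1)%N.
Definition hpart (la : seq nat) (i : nat) : nat := (\sum_(1 <= j < i.+1) conjp la j)%N.

Definition cf (q : nat) (f : {poly F}) (la : seq nat) : rat :=
  let e := (size f).-1 in
  \prod_(1 <= i < (sumn la).+1)
    \prod_(1 <= j < (mpart la i).+1)
      ((q%:R : rat) ^+ (e * hpart la i) - (q%:R : rat) ^+ (e * (hpart la i - j))).

Definition Pprod (k : nat) (p : 'I_k -> {poly F}) : {poly F} := \prod_(i < k) p i.

(* S(I): monic irreducible divisors of P (all have size <= size P, so they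
   occur among the polynomials with at most size P coefficients) *)
Definition Sset (k : nat) (p : 'I_k -> {poly F}) : seq {poly F} :=
  let P := Pprod p in
  undup [seq f <- [seq \poly_(i < size P) (nth 0 t i) | t : (size P).-tuple F]
         | [&& f \is monic, pbool (irreducible_poly f) & f %| P]].

Definition Phi (k : nat) (p : 'I_k -> {poly F}) (f : {poly F}) : seq nat :=
  [seq m <- rev [seq nu f (p i) | i <- enum 'I_k] | (0 < m)%N].

End Defs.

(* Main.v *)
Require Import Defs.
From HB Require Import structures.
From mathcomp Require Import all_boot all_order all_fingroup all_algebra.
From mathcomp Require Import mxabelem ring zify.
Set Implicit Arguments. Unset Strict Implicit. Unset Printing Implicit Defensive.
Import Order.TTheory GRing.Theory Num.Theory.
Local Open Scope ring_scope.

(* Write the transpose of B as [C | D] with C square.  A subspace X of W is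
   T-invariant iff X C <= X and X D = 0, and after a change of basis taking U to
   the first d coordinates, U is the maximal one iff C = [A 0; E C'], D = [0; D']
   with (C', D') observable, i.e. with no nonzero invariant subspace.  Then
   [X - C' | - D'] has a right inverse, so X I - B has the same determinantal
   divisors as diag(X - A, 1): the invariant factors only constrain A.

   Counting observable pairs: classifying all pairs (C, D) by their maximal
   invariant subspace gives a recursion, solved by a q-binomial identity.

   Counting the A with given invariant factors: by the Smith form of X - A the
   invariant factors are encoded by the nullities of all g(A), so membership in
   the class only depends on these nullities.  Call y_1, ..., y_l independent of
   type (f_1^a_1, ..., f_l^a_l) when the F[X]-module they generate is the direct
   sum of the F[X]/(f_i^a_i) with generators y_i.  Choosing y_l, ..., y_1
   successively, the number of choices at each step is a difference of two powers
   of q depending only on the nullities of A, and these differences are the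
   factors of the c_f.  If A0 has an independent generating family x, then
   g |-> (x_i g) is a bijection from the invertible g with A0 g = g A onto the
   families of that type for A; summing over A, |GL_d| is the size of the class
   times the product of the c_f. *)

(** * The F[X]-module defined by a matrix *)

Section Peval.
Variable F : fieldType.

(* [horner_mx] is only available in positive dimension. *)
Definition peval n : 'M[F]_n -> {poly F} -> 'M[F]_n :=
  if n is n'.+1 then fun A p => horner_mx A p else fun _ _ => 0.

Variables (n : nat) (A : 'M[F]_n).
Implicit Types (p g c : {poly F}) (u v y : 'rV[F]_n).

Lemma pevalD p g : peval A (p + g) = peval A p + peval A g.
Proof. by case: n A => [|n'] A' /=; rewrite ?addr0 ?rmorphD. Qed.
Lemma pevalN p : peval A (- p) = - peval A p.
Proof. by case: n A => [|n'] A' /=; rewrite ?oppr0 ?rmorphN. Qed.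
Lemma peval0 : peval A 0 = 0.
Proof. by case: n A => [|n'] A' /=; rewrite ?rmorph0. Qed.
Lemma peval1 : peval A 1 = 1%:M.
Proof. by case: n A => [|n'] A' /=; rewrite ?rmorph1 // [RHS]flatmx0. Qed.
Lemma pevalC a : peval A a%:P = a%:M.
Proof. by case: n A => [|n'] A' /=; rewrite ?horner_mx_C // [RHS]flatmx0. Qed.
Lemma pevalX : peval A 'X = A.
Proof. by case: n A => [|n'] A' /=; rewrite ?horner_mx_X // [RHS]flatmx0. Qed.
Lemma pevalM p g : peval A (p * g) = peval A p *m peval A g.
Proof. by case: n A => [|n'] A' /=; rewrite ?rmorphM // [RHS]flatmx0. Qed.
Lemma pevalZ a p : peval A (a *: p) = a *: peval A p.
Proof. by rewrite -mul_polyC pevalM pevalC mul_scalar_mx. Qed.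
Lemma peval_sum I (r : seq I) (P : pred I) (E : I -> {poly F}) :
  peval A (\sum_(i <- r | P i) E i) = \sum_(i <- r | P i) peval A (E i).
Proof. exact: (big_morph _ pevalD peval0). Qed.
Lemma peval_char_poly : peval A (char_poly A) = 0.
Proof. by case: n A => [|n'] A' //=; apply: Cayley_Hamilton. Qed.

(** Turns polynomial relations on [y] into linear algebra: the coefficient row multiplies the Krylov
    matrix with rows [y] A^j. *)
Lemma peval_rVpoly m y (w : 'rV_m) :
  y *m peval A (rVpoly w) = w *m \matrix_(j < m) (y *m peval A 'X^j).
Proof.
rewrite /rVpoly poly_def peval_sum mulmx_sumr mulmx_sum_row; apply: eq_bigr => i _.
by rewrite pevalZ -scalemxAr rowK insubT // => lt_im; congr (w _ _ *: _); apply: val_inj.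
Qed.

Definition cyc y : 'M[F]_n := \matrix_(j < n) (y *m peval A 'X^j).

(** By Cayley-Hamilton, [c] may be reduced modulo the characteristic polynomial, so the first [n]
    powers of A suffice. *)
Lemma cycP u y : reflect (exists c, u = y *m peval A c) (u <= cyc y)%MS.
Proof.
apply: (iffP submxP) => [[w ->]|[c ->]].
  by exists (rVpoly w); rewrite peval_rVpoly.
exists (poly_rV (c %% char_poly A)).
have szr : (size (c %% char_poly A)%R <= n)%N.
  by rewrite -ltnS -(size_char_poly A) ltn_modp -size_poly_eq0 size_char_poly.
rewrite -/(cyc y) -peval_rVpoly poly_rV_K // {1}(divp_eq c (char_poly A)).
by rewrite pevalD pevalM peval_char_poly mulmx0 add0r.
Qed.

Fixpoint cspan (ys : seq 'rV[F]_n) : 'M[F]_n :=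
  if ys is y :: ys' then (cyc y + cspan ys')%MS else 0.

Lemma cspan_consP u y ys :
  reflect (exists c v, (v <= cspan ys)%MS /\ u = y *m peval A c + v)
          (u <= cspan (y :: ys))%MS.
Proof.
apply: (iffP idP) => [/sub_addsmxP [[w1 w2] /= ->] | [c [v [vy ->]]]].
  have /cycP [c ->] : (w1 *m cyc y <= cyc y)%MS by apply: submxMl.
  by exists c, (w2 *m cspan ys); split => //; apply: submxMl.
apply: addmx_sub_adds => //; apply/cycP; by exists c.
Qed.

Lemma cspan_peval u ys c : (u <= cspan ys)%MS -> (u *m peval A c <= cspan ys)%MS.
Proof.
elim: ys u => [|y ys IH] u; first by rewrite /= !submx0 => /eqP ->; rewrite mul0mx.
case/cspan_consP => c' [v [vy ->]]; apply/cspan_consP; exists (c' * c), (v *m peval A c).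
by split; [apply: IH | rewrite mulmxDl pevalM mulmxA].
Qed.

(* The cyclic modules generated by the [y_i] are in direct sum, and that of
   [y_i] is isomorphic to F[X]/(m_i). *)
Fixpoint ind (ms : seq {poly F}) (ys : seq 'rV[F]_n) : Prop :=
  match ms, ys with
  | [::], [::] => True
  | m :: ms', y :: ys' =>
      [/\ y *m peval A m = 0,
          forall c, (y *m peval A c <= cspan ys')%MS -> m %| c & ind ms' ys']
  | _, _ => False
  end.

Lemma ind_size ms ys : ind ms ys -> size ys = size ms.
Proof. by elim: ms ys => [|m ms IH] [|y ys] //= [_ _ /IH ->]. Qed.

Lemma peval_dvd y m c : y *m peval A m = 0 -> m %| c -> y *m peval A c = 0.
Proof.
by move=> ym /dvdpP [h ->]; rewrite mulrC pevalM mulmxA ym mul0mx.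
Qed.

(** Reduction modulo [m] leaves deg m Krylov rows for each generator, and independence makes them
    free modulo the other generators. *)
Lemma rank_cspan ms ys : all (predC1 0) ms -> ind ms ys ->
  \rank (cspan ys) = (\sum_(m <- ms) (size m).-1)%N.
Proof.
elim: ms ys => [|m ms IH] [|y ys] //=; first by rewrite big_nil mxrank0.
case/andP => m0 ms0 [ym my yi]; rewrite big_cons -(IH _ ms0 yi).
set K : 'M_((size m).-1, n) := \matrix_(j < (size m).-1) (y *m peval A 'X^j).
(* Here [m] divides a polynomial of smaller degree, which is therefore zero. This yields both the
   freeness of [K] and the trivial intersection. *)
have lem (w : 'rV_(size m).-1) : (w *m K <= cspan ys)%MS -> w = 0.
  rewrite /K -peval_rVpoly => /my /dvdp_leq le; apply: (can_inj rVpolyK).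
  rewrite linear0; apply: contraTeq (size_poly _ _ : size (rVpoly w) <= _)%N => w0.
  by rewrite -ltnNge (leq_trans _ (le w0)) // prednK // lt0n size_poly_eq0.
have eqK : (cyc y :=: K)%MS.
  apply/eqmxP; rewrite andbC; apply/andP; split; apply/row_subP => i.
    by rewrite rowK; apply/cycP; exists 'X^i.
  have /cycP [c ->] : (row i (cyc y) <= cyc y)%MS by apply: row_sub.
  apply/submxP; exists (poly_rV (c %% m)); rewrite /K -peval_rVpoly poly_rV_K.
    by rewrite {1}(divp_eq c m) pevalD mulmxDr mulrC pevalM mulmxA ym mul0mx add0r.
  by rewrite -ltnS prednK ?lt0n ?size_poly_eq0 // ltn_modp.
have capK : (K :&: cspan ys = 0)%MS.
  apply/eqP; rewrite -submx0; apply/row_subP => i.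
  have := row_sub i (K :&: cspan ys)%MS; rewrite sub_capmx => /andP [/submxP [w ->] h].
  by rewrite (lem _ h) mul0mx sub0mx.
have rK : \rank K = (size m).-1.
  apply/eqP; rewrite -[_ == _]/(row_free K) -kermx_eq0 -submx0.
  apply/row_subP => i; rewrite [row i _]lem ?sub0mx //.
  by rewrite (sub_kermxP (row_sub i _)) sub0mx.
by rewrite (adds_eqmx eqK (eqmx_refl _)) mxrank_disjoint_sum // rK.
Qed.

(** In F[X]/(m) the kernel of g is generated by m / gcd(m, g), whose annihilator is gcd(m, g); the
    kernel in a direct sum is computed summand by summand. *)
Lemma ind_cap ms ys g : all (predC1 0) ms -> ind ms ys ->
  exists2 zs, ind [seq gcdp m g | m <- ms] zs &
    forall u, (u <= cspan zs)%MS = ((u <= cspan ys)%MS && (u *m peval A g == 0)).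
Proof.
elim: ms ys => [|m ms IH] [|y ys] //=.
  by exists [::] => // u; rewrite submx0; case: eqP => // ->; rewrite mul0mx eqxx.
case/andP => m0 ms0 [ym my yi]; have [zs zi zP] := IH _ ms0 yi.
have gd : gcdp m g %| m by apply: dvdp_gcdl.
have g0 : gcdp m g != 0 by rewrite gcdp_eq0 (negPf m0).
have dm0 : m %/ gcdp m g != 0.
  by apply: contraNneq m0 => e; rewrite -(divpK gd) e mul0r.
pose z := y *m peval A (m %/ gcdp m g).
exists (z :: zs) => [|u].
  split=> //.
  - by rewrite /z -mulmxA -pevalM divpK.
  - move=> c; rewrite zP => /andP [le _]; rewrite -(dvdp_mul2l _ _ dm0) divpK //.
    by apply: my; rewrite pevalM mulmxA.
apply/cspan_consP/andP => [[c [v [vz ->]]] | [/cspan_consP [c [v [vy ->]]] /eqP e]].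
  move: vz; rewrite zP => /andP [vy /eqP vg]; split.
    apply/cspan_consP; exists (m %/ gcdp m g * c), v.
    by rewrite /z pevalM mulmxA.
  rewrite mulmxDl vg addr0 /z -!mulmxA -!pevalM (peval_dvd ym) //.
  by rewrite mulrCA dvdp_mull // -{1}(divpK gd) dvdp_mul // dvdp_gcdr.
have ecg : m %| c * g.
  apply: my; rewrite pevalM mulmxA; move/eqP: e; rewrite mulmxDl addr_eq0 => /eqP ->.
  by rewrite -mulNmx; apply: cspan_peval; rewrite eqmx_opp.
have vg : v *m peval A g = 0.
  by move: e; rewrite mulmxDl -mulmxA -pevalM (peval_dvd ym ecg) add0r.
have /dvdpP [h hc] : m %/ gcdp m g %| c.
  have : m %| c * gcdp m g.
    by rewrite (eqp_dvdr _ (mulp_gcdr _ _ _)) dvdp_gcd dvdp_mull.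
  by rewrite -{1}(divpK gd) dvdp_mul2r.
exists h, v; split; first by rewrite zP vy vg /=.
by rewrite hc /z -mulmxA -pevalM mulrC.
Qed.
End Peval.

Lemma pboolP (P : Prop) : reflect P (pbool P).
Proof.
by rewrite /pbool; case: ClassicalEpsilon.excluded_middle_informative => h; constructor.
Qed.

(** Serves to add one generator to an independent family, and later one row to a free matrix. *)
Lemma card_fibers (T1 T2 : finType) (P : pred T2) (Q : T1 -> T2 -> bool) N :
  (forall t2, P t2 -> #|[set t1 | Q t1 t2]| = N) ->
  #|[set p : T1 * T2 | P p.2 && Q p.1 p.2]| = (N * #|[set t | P t]|)%N.
Proof.
move=> fibN; transitivity (\sum_t1 \sum_(t2 | P t2 && Q t1 t2) 1)%N.
  by rewrite pair_big_dep -sum1dep_card.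
rewrite (exchange_big_dep P) => [|t1 t2 _ /andP []] //=.
rewrite mulnC -sum_nat_const big_mkcond [RHS]big_mkcond /=; apply: eq_bigr => t2 _.
rewrite inE; case: ifP => // Pt2; rewrite -(fibN _ Pt2) -sum1dep_card.
by under eq_bigl do rewrite Pt2.
Qed.

Section Irred.
Variable F : fieldType.
Implicit Types f c : {poly F}.

Lemma irreducible_ndvd_coprime f c : irreducible_poly f -> ~~ (f %| c) -> coprimep f c.
Proof.
move=> irrf; apply: contraNT => co; rewrite -(eqp_dvdl _ (irrf.2 _ co _)) ?dvdp_gcdl //.
exact: dvdp_gcdr.
Qed.

Lemma irreducible_exp_split f a c : irreducible_poly f -> ~~ (f ^+ a %| c) ->
  exists t c', [/\ (t < a)%N, c = f ^+ t * c' & coprimep f c'].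
Proof.
move=> irrf; have f0 := irredp_neq0 irrf; elim: a c => [|a IH] c; first by rewrite expr0 dvd1p.
have [/dvdpP [c1 ->] | /irreducible_ndvd_coprime co _] := boolP (f %| c); last first.
  by exists 0%N, c; rewrite expr0 mul1r co.
rewrite exprSr dvdp_mul2r //; case/IH=> t [c' [lt_ta -> co]].
by exists t.+1, c'; rewrite exprSr mulrAC.
Qed.
End Irred.

Section Ind.
Variables (F : fieldType) (n : nat) (A : 'M[F]_n).
Implicit Types (f g c : {poly F}) (u y : 'rV[F]_n) (ms : seq {poly F}) (ys : seq 'rV[F]_n).

(** When the family generates the whole space, the submodule found by [ind_cap] is the full kernel
    of g(A), and [rank_cspan] gives its dimension. *)
Lemma rank_kermx_peval ms ys g : all (predC1 0) ms -> ind A ms ys ->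
  (1%:M <= cspan A ys)%MS ->
  \rank (kermx (peval A g)) = (\sum_(m <- ms) (size (gcdp m g)).-1)%N.
Proof.
move=> ms0 yi full; have [zs zi zP] := ind_cap g ms0 yi.
have gs0 : all (predC1 0) [seq gcdp m g | m <- ms].
  rewrite all_map; apply: sub_all ms0 => m /=; apply: contraNneq => /eqP.
  by rewrite gcdp_eq0 => /andP [].
rewrite -(big_map (fun m => gcdp m g) xpredT (fun m => (size m).-1)) -(rank_cspan gs0 zi).
apply/eqmx_rank/rV_eqP => u; rewrite zP sub_kermx (submx_trans _ full) //.
by rewrite submx1.
Qed.

(** In F[X]/(m) the kernel of f is zero if m is coprime to f; if f^(a+1) divides m, it consists of
    multiples of m / f, hence of f^a. *)
Lemma cspan_ker_image ms ys f a u :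
  f != 0 -> (forall m, m \in ms -> coprimep m f \/ f ^+ a.+1 %| m) -> ind A ms ys ->
  (u <= cspan A ys)%MS -> u *m peval A f = 0 -> exists v, u = v *m peval A (f ^+ a).
Proof.
move=> f0; elim: ms ys u => [|m ms IH] [|y ys] //= u ms_f.
  by move=> _; rewrite submx0 => /eqP -> _; exists 0; rewrite mul0mx.
case=> ym my yi /cspan_consP [c [v [vy ->]]] /eqP e.
have ecf : m %| c * f.
  apply: my; rewrite pevalM mulmxA; move: e; rewrite mulmxDl addr_eq0 => /eqP ->.
  by rewrite -mulNmx; apply: cspan_peval; rewrite eqmx_opp.
have vf : v *m peval A f = 0.
  by move: e; rewrite mulmxDl -mulmxA -pevalM (peval_dvd ym ecf) add0r => /eqP.
have [|w ->] := IH ys v _ yi vy vf; first by move=> m' im'; apply: ms_f; rewrite inE im' orbT.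
have [co|fm] := ms_f m (mem_head _ _).
  by rewrite (peval_dvd ym) ?add0r; [exists w | rewrite -(Gauss_dvdpl _ co)].
have /dvdpP [h ->] : f ^+ a %| c.
  by rewrite -(dvdp_mul2r _ _ f0) -exprSr (dvdp_trans fm).
by exists (y *m peval A h + w); rewrite mulmxDl pevalM mulmxA.
Qed.

(** The polynomials sending [y] into the span of [ys] form an ideal containing f^(a+1), so it is
    generated by a power of f; it equals (f^(a+1)) iff it misses f^a. *)
Lemma ind_cons_irred f a y ys : irreducible_poly f -> y *m peval A (f ^+ a.+1) = 0 ->
  (forall c, (y *m peval A c <= cspan A ys)%MS -> f ^+ a.+1 %| c) <->
  ~~ (y *m peval A (f ^+ a) <= cspan A ys)%MS.
Proof.
move=> irrf yf; have f0 := irredp_neq0 irrf; split.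
  move=> h; apply/negP => /h; rewrite exprS -{2}[f ^+ a]mul1r dvdp_mul2r ?expf_neq0 //.
  by rewrite dvdp1; case: irrf => sf _ /eqP sf1; rewrite sf1 in sf.
move=> nin c yc; apply: contraNT nin => /(irreducible_exp_split irrf).
case=> t [c' [le_ta def_c co]].
(* Multiplying the Bezout relation by f^a exhibits f^a in the ideal generated by f^(a+1) and [c]. *)
have /Bezout_eq1_coprimepP [[u v] /= e] := coprimep_expl a.+1 co.
have -> : f ^+ a = f ^+ a.+1 * (u * f ^+ a) + c * (v * f ^+ (a - t)).
  have -> : c * (v * f ^+ (a - t)) = f ^+ a * (v * c').
    rewrite def_c -[in RHS](subnKC (le_ta : (t <= a)%N)) exprD -!mulrA; congr (_ * _).
    by ring.
  by rewrite -[LHS]mulr1 -e mulrDr; congr (_ + _); rewrite mulrCA [RHS]mulrCA [_ * f ^+ a]mulrC.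
rewrite pevalD mulmxDr pevalM mulmxA yf mul0mx add0r pevalM mulmxA.
exact: cspan_peval.
Qed.
End Ind.

(** * Counting independent families *)

Section Count.
Variables (F : finFieldType).
Implicit Types (f g c : {poly F}) (ms : seq {poly F}) (s : seq ({poly F} * nat)).

Definition nullity n (A : 'M[F]_n) g := \rank (kermx (peval A g)).
Definition ppowers s := [seq x.1 ^+ x.2 | x <- s].
Definition indset n (A : 'M[F]_n) ms : {set (size ms).-tuple 'rV[F]_n} :=
  [set t : (size ms).-tuple 'rV[F]_n | pbool (ind A ms t)].

Lemma ppowers_neq0 s : {in s, forall x, irreducible_poly x.1} -> all (predC1 0) (ppowers s).
Proof.
move=> irr; apply/allP => m /mapP [x xs ->] /=.
by rewrite expf_neq0 // irredp_neq0 //; apply: irr.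
Qed.

Lemma irreducible_monic_coprime f g : irreducible_poly f -> irreducible_poly g ->
  f \is monic -> g \is monic -> g != f -> coprimep g f.
Proof.
move=> irrf irrg fm gm ne; apply: irreducible_ndvd_coprime => //; apply: contra ne => gf.
rewrite -eqp_monic //; apply: irrf.2 => //; apply: contraTneq irrg.1 => ->.
by rewrite ltnn.
Qed.

Lemma size_gcdp_irred_exp f g a : irreducible_poly f -> irreducible_poly g ->
  f \is monic -> g \is monic -> (0 < a)%N ->
  (size (gcdp (g ^+ a) f)).-1 = ((size f).-1 * (g == f))%N.
Proof.
move=> irrf irrg fm gm; case: a => // a _.
have [->|ne] := eqVneq g f.
  by rewrite muln1 exprS (eqp_size (eqp_trans (gcdpC _ _) (gcdp_mulr _ _))).
rewrite muln0; have /eqP -> // : coprimep (g ^+ a.+1) f.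
by apply/coprimep_expl/irreducible_monic_coprime.
Qed.

(** By [ind_cons_irred] the admissible y are the vectors of the kernel of f^(a+1)(A) outside the
    subspace [Y] of those sent by f^a(A) into [Z], the kernel of f(A) in the span of [ys]. Each
    entry of [s] at f contributes deg f to the dimension of [Z], and the other entries contribute
    nothing. *)
Lemma card_extension n (A : 'M[F]_n) f a s (ys : seq 'rV[F]_n) :
  irreducible_poly f -> f \is monic ->
  {in s, forall x, [/\ irreducible_poly x.1, x.1 \is monic, (0 < x.2)%N &
     x.1 = f -> (a < x.2)%N]} ->
  ind A (ppowers s) ys ->
  #|[set y : 'rV[F]_n | pbool (ind A (f ^+ a.+1 :: ppowers s) (y :: ys))]| =
    (#|F| ^ nullity A (f ^+ a.+1) -
     #|F| ^ (nullity A (f ^+ a) + (size f).-1 * count (fun x => x.1 == f) s))%N.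
Proof.
move=> irrf fm sP yi; have f0 := irredp_neq0 irrf.
have s0 : all (predC1 0) (ppowers s) by apply: ppowers_neq0 => x /sP [].
have [zs zi zP] := ind_cap f s0 yi.
pose h := peval A (f ^+ a); pose Z := cspan A zs; pose Y := kermx (h *m cokermx Z).
have YP u : (u <= Y)%MS = (u *m h <= Z)%MS by rewrite sub_kermx mulmxA submxE.
have rZ : \rank Z = ((size f).-1 * count (fun x => x.1 == f) s)%N.
  rewrite (rank_cspan _ zi); last first.
    rewrite all_map; apply: sub_all s0 => m /=; apply: contraNneq => /eqP.
    by rewrite gcdp_eq0 => /andP [].
  rewrite !big_map -sum1_count big_distrr /= [RHS]big_mkcond /= !big_seq.
  apply: eq_bigr => x /sP [irrx xm x0 _].
  by rewrite size_gcdp_irred_exp //; case: eqP => _; rewrite ?muln0 ?muln1.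
(* Surjectivity onto [Z] is where the exponents of f in [s] have to exceed [a]: then
   [cspan_ker_image] makes [Z] part of the image of f^a(A). *)
have eZ : (Y *m h :=: Z)%MS.
  apply/eqmxP/rV_eqP => u; apply/idP/idP => [/submxP [w ->]|uZ].
    by rewrite mulmxA -YP submxMl.
  have: (u <= Z)%MS by []; rewrite zP => /andP [uy /eqP uf].
  have [|v ev] := cspan_ker_image f0 _ yi uy uf (a := a).
    move=> m /mapP [x /sP [irrx xm x0 xf] ->].
    have [/[dup] /xf lt_ax -> | ne] := eqVneq x.1 f.
      by right; rewrite dvdp_exp2l.
    by left; apply/coprimep_expl/irreducible_monic_coprime.
  by rewrite ev submxMr // YP -ev.
have rY : \rank Y = (nullity A (f ^+ a) + \rank Z)%N.
  rewrite -(mxrank_mul_ker Y h) eZ addnC; congr addn.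
  apply/eqmx_rank/eqmxP/capmx_idPr/rV_subP => u; rewrite sub_kermx YP => /eqP ->.
  exact: sub0mx.
rewrite -rZ -rY -!card_rowg.
have sYK : rowg Y \subset rowg (kermx (peval A (f ^+ a.+1))).
  rewrite rowgS; apply/rV_subP => u; rewrite YP zP => /andP [_].
  by rewrite sub_kermx exprSr pevalM mulmxA.
rewrite -(setIidPr sYK) -cardsD; apply: eq_card => y; rewrite !inE YP.
apply/pboolP/andP => /= [[yf yc _] | [nin yf]].
  split; last by rewrite sub_kermx yf.
  rewrite zP negb_and; apply/orP; left; exact/(ind_cons_irred ys irrf yf).
have {}yf : y *m peval A (f ^+ a.+1) = 0 by apply/eqP; rewrite -sub_kermx.
split => //; apply/(ind_cons_irred ys irrf yf); apply: contra nin => yin.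
by rewrite zP yin -mulmxA -pevalM -exprSr yf eqxx.
Qed.

Lemma card_indset_cons n (A : 'M[F]_n) f a s :
  irreducible_poly f -> f \is monic ->
  {in s, forall x, [/\ irreducible_poly x.1, x.1 \is monic, (0 < x.2)%N &
     x.1 = f -> (a < x.2)%N]} ->
  #|indset A (ppowers ((f, a.+1) :: s))| =
    ((#|F| ^ nullity A (f ^+ a.+1) -
     #|F| ^ (nullity A (f ^+ a) + (size f).-1 * count (fun x => x.1 == f) s))
     * #|indset A (ppowers s)|)%N.
Proof.
move=> irrf fm sP.
rewrite -(card_fibers (Q := fun y (t : (size (ppowers s)).-tuple _) => pbool (ind A
  (ppowers ((f, a.+1) :: s)) (y :: t)))); last first.
  by move=> t /pboolP; apply: card_extension.
have h_inj : injective (fun p : 'rV[F]_n * (size (ppowers s)).-tuple 'rV[F]_n => [tuple of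
  p.1 :: p.2]).
  by move=> [y t] [y' t'] /(congr1 val) [-> /val_inj ->].
rewrite -(card_imset _ h_inj); apply: eq_card => /= t.
rewrite inE; apply/pboolP/imsetP => [|[[y t'] /=]]; last first.
  by rewrite inE => /andP [_ /pboolP yi] ->.
case/tupleP: t => y t yi; exists (y, t); last by apply: val_inj.
by rewrite inE /=; apply/andP; split; apply/pboolP => //; case: yi.
Qed.
End Count.

(** * Intertwining matrices *)

Section Comb.
Variable F : fieldType.
Implicit Types (p c : {poly F}) (cs : nat -> {poly F}) (ms : seq {poly F}).

Lemma peval_intertwine n n' (A : 'M[F]_n) (A' : 'M[F]_n') (g : 'M_(n, n')) p :
  A *m g = g *m A' -> peval A p *m g = g *m peval A' p.
Proof.
move=> Ag; elim/poly_ind: p => [|p c IH]; first by rewrite !peval0 mulmx0 mul0mx.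
rewrite !pevalD !pevalM !pevalX !pevalC mulmxDl mulmxDr scalar_mxC; congr (_ + _).
by rewrite -mulmxA Ag !mulmxA IH.
Qed.

(** Coefficients are a function on [nat], so that passing to the tail of the list is a mere
    shift. *)
Fixpoint comb n (A : 'M[F]_n) (xs : seq 'rV[F]_n) cs : 'rV[F]_n :=
  if xs is x :: xs' then x *m peval A (cs 0) + comb A xs' (fun i => cs i.+1) else 0.

Variables (n : nat) (A : 'M[F]_n).
Implicit Type xs : seq 'rV[F]_n.

Lemma comb_peval xs cs c : comb A xs (fun i => cs i * c) = comb A xs cs *m peval A c.
Proof.
elim: xs cs => [|x xs IH] cs /=; first by rewrite mul0mx.
by rewrite IH mulmxDl pevalM mulmxA.
Qed.

Lemma comb_sum xs I (r : seq I) (a : I -> F) (C : I -> nat -> {poly F}) :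
  comb A xs (fun i => \sum_(t <- r) a t *: C t i) = \sum_(t <- r) a t *: comb A xs (C t).
Proof.
elim: xs C => [|x xs IH] C /=; first by rewrite big1 // => t _; rewrite scaler0.
rewrite IH peval_sum mulmx_sumr -big_split; apply: eq_bigr => t _ /=.
by rewrite pevalZ -scalemxAr scalerDr.
Qed.

Lemma combB xs cs cs' : comb A xs (fun i => cs i - cs' i) = comb A xs cs - comb A xs cs'.
Proof.
elim: xs cs cs' => [|x xs IH] cs cs' /=; first by rewrite subr0.
by rewrite IH pevalD pevalN mulmxDr mulmxN opprD addrACA.
Qed.

Lemma combP xs u : reflect (exists cs, u = comb A xs cs) (u <= cspan A xs)%MS.
Proof.
apply: (iffP idP) => [|[cs ->]].
  elim: xs u => [|x xs IH] u; first by rewrite submx0 => /eqP ->; exists (fun=> 0).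
  case/cspan_consP => c [v [/IH [cs ->] ->]].
  by exists (fun i => if i is j.+1 then cs j else c).
elim: xs cs => [|x xs IH] cs; first exact: sub0mx.
by apply/cspan_consP; exists (cs 0%N), (comb A xs (fun i => cs i.+1)).
Qed.

Lemma comb_delta xs i : (i < size xs)%N -> comb A xs (fun j => (j == i)%:R) = xs`_i.
Proof.
have comb0 ys : comb A ys (fun=> 0) = 0.
  by elim: ys => //= y ys ->; rewrite peval0 mulmx0 addr0.
elim: xs i => [|x xs IH] [|i] //= lt_i; first by rewrite comb0 peval1 mulmx1 addr0.
by rewrite peval0 mulmx0 add0r IH.
Qed.

(** Hence the relations of an independent family depend on [ms] alone, neither on the matrix nor on
    the vectors. *)
Lemma comb_eq0 ms xs cs : ind A ms xs ->
  comb A xs cs = 0 <-> forall i, (i < size ms)%N -> ms`_i %| cs i.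
Proof.
elim: ms xs cs => [|m ms IH] [|x xs] cs //= [xm mx xi]; split => [e|dv].
  have dv0 : m %| cs 0%N.
    apply: mx; move/eqP: e; rewrite addr_eq0 => /eqP ->; rewrite eqmx_opp.
    by apply/combP; eexists.
  case=> [|i] //= lt_i; apply: (IH _ (fun i => cs i.+1) xi).1 lt_i.
  by move: e; rewrite (peval_dvd xm dv0) add0r.
rewrite (peval_dvd xm (dv 0%N isT)) add0r.
by apply/(IH _ (fun i => cs i.+1) xi) => i lt_i; apply: (dv i.+1).
Qed.
End Comb.

Section Intertwine.
Variables (F : fieldType) (n : nat).
Implicit Types (A g : 'M[F]_n) (xs : seq 'rV[F]_n) (ms : seq {poly F}).

Lemma comb_map A (A' : 'M[F]_n) g xs cs : A *m g = g *m A' ->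
  comb A' (map (mulmx^~ g) xs) cs = comb A xs cs *m g.
Proof.
move=> Ag; elim: xs cs => [|x xs IH] cs /=; first by rewrite mul0mx.
by rewrite IH mulmxDl -!mulmxA (peval_intertwine _ Ag).
Qed.

Lemma ind_map A (A' : 'M[F]_n) g ms xs : A *m g = g *m A' -> g \in unitmx -> ind A ms xs ->
  ind A' ms (map (mulmx^~ g) xs).
Proof.
move=> Ag gu; elim: ms xs => [|m ms IH] [|x xs] //= [xm mx xi]; split; last exact: IH.
  by rewrite -mulmxA -(peval_intertwine _ Ag) mulmxA xm mul0mx.
move=> c /combP [cs]; rewrite (comb_map _ _ Ag) -mulmxA -(peval_intertwine _ Ag) mulmxA.
by move/(can_inj (mulmxK gu)) => e; apply: mx; apply/combP; exists cs.
Qed.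

(** Both families have the same relations by [comb_eq0], so sending a combination of [xs] to the
    same combination of [ys] is well defined, injective and compatible with X. As [xs] generates the
    space, this map is a square matrix. *)
Lemma ind_similar A (A' : 'M[F]_n) ms xs ys : ind A ms xs -> ind A' ms ys ->
  (1%:M <= cspan A xs)%MS ->
  exists g, [/\ g \in unitmx, A *m g = g *m A' & map (mulmx^~ g) xs = ys].
Proof.
move=> xi yi full.
have allspan u : exists cs, u = comb A xs cs.
  by apply/combP; apply: submx_trans full; rewrite submx1.
have [C CP] : exists C : 'I_n -> nat -> {poly F}, forall t, delta_mx 0 t = comb A xs (C t).
  exists (fun t => projT1 (ClassicalEpsilon.constructive_indefinite_description _ (allspan
    (delta_mx 0 t)))) => t.
  by case: ClassicalEpsilon.constructive_indefinite_description.
pose g := \matrix_t comb A' ys (C t).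
(* [cs'] expands the vector through the chosen coefficients [C] of the unit vectors; [cs] and [cs']
   differ by a relation of [xs], which is also one of [ys]. *)
have combg cs : comb A xs cs *m g = comb A' ys cs.
  pose cs' i := \sum_t (comb A xs cs) 0 t *: C t i.
  have -> : comb A xs cs *m g = comb A' ys cs'.
    rewrite /cs' comb_sum mulmx_sum_row; apply: eq_bigr => t _.
    by rewrite rowK.
  apply/eqP; rewrite eq_sym -subr_eq0 -combB; apply/eqP.
  apply/(comb_eq0 _ yi)/(comb_eq0 _ xi); rewrite combB /cs' comb_sum.
  rewrite {1}[comb A xs cs]row_sum_delta -sumrB big1 // => t _.
  by rewrite -CP subrr.
have Ag : A *m g = g *m A'.
  apply/row_matrixP => t; rewrite !rowE !mulmxA (CP t) combg.
  by have := combg (fun i => C t i * 'X); rewrite !comb_peval !pevalX.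
have gu : g \in unitmx.
  rewrite -row_free_unit -kermx_eq0; apply/eqP/row_matrixP => i; rewrite row0.
  have [cs e] := allspan (row i (kermx g)); rewrite e.
  apply/(comb_eq0 _ xi)/(comb_eq0 _ yi); rewrite -combg -e.
  exact/sub_kermxP/row_sub.
exists g; split=> //.
apply: (eq_from_nth (x0 := 0)) => [|i]; rewrite size_map ?(ind_size xi) ?(ind_size yi) //.
move=> lt_i; rewrite (nth_map 0) ?(ind_size xi) //.
by rewrite -(comb_delta A) ?(ind_size xi) // combg comb_delta ?(ind_size yi).
Qed.
End Intertwine.

(** * Matrices with prescribed nullities *)

Section Class.
Variables (F : finFieldType) (n : nat).
Implicit Types (A g : 'M[F]_n) (s : seq ({poly F} * nat)).

(* For each f the exponents increase along the list: families are built from the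
   tail, so a new generator always has the smallest exponent so far. *)
Fixpoint divisor_type s : Prop :=
  if s is x :: s' then
    [/\ irreducible_poly x.1, x.1 \is monic, (0 < x.2)%N,
        {in s', forall y, y.1 = x.1 -> (x.2 <= y.2)%N} & divisor_type s']
  else True.

Lemma divisor_type_in s : divisor_type s ->
  {in s, forall x, [/\ irreducible_poly x.1, x.1 \is monic & (0 < x.2)%N]}.
Proof.
elim: s => //= x s IH [irrx xm x0 _ /IH gs] y.
by rewrite inE => /orP [/eqP -> | /gs].
Qed.

(** The product of the numbers of choices in [card_extension], with the nullities abstracted to a
    function: it takes one value on all matrices having the same nullities. *)
Definition typecount (nu : {poly F} -> nat) : seq ({poly F} * nat) -> nat :=
  fix loop s := if s is x :: s' then
    ((#|F| ^ nu (x.1 ^+ x.2) -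
      #|F| ^ (nu (x.1 ^+ x.2.-1) + (size x.1).-1 * count (fun y => y.1 == x.1) s'))
     * loop s')%N else 1%N.

Lemma card_indset A s : divisor_type s -> #|indset A (ppowers s)| = typecount (nullity A) s.
Proof.
elim: s => [|[f [|a]] s IH] //=; last first.
- case=> irrf fm _ sf gs; rewrite -IH // card_indset_cons // => x xs.
  by have [irrx xm x0] := divisor_type_in gs xs; split=> //; apply: sf.
- by case.
by move=> _; apply: (@eq_card1 _ [tuple]) => t; rewrite [t]tuple0 !inE eqxx; apply/pboolP.
Qed.

Lemma similar_nul A (A' : 'M[F]_n) g p : g \in unitmx -> A *m g = g *m A' ->
  nullity A' p = nullity A p.
Proof.
move=> gu /(peval_intertwine p) e; rewrite /nullity !mxrank_ker; congr (_ - _)%N.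
by rewrite -[RHS](mxrankMfree _ (_ : row_free g)) ?row_free_unit // e eqmxMfull ?row_full_unit.
Qed.

(** An intertwiner is determined by the images of the generators [xs], which are independent for
    [A'] by [ind_map]; [ind_similar] provides the surjectivity. *)
Lemma card_intertwiners A (A' : 'M[F]_n) ms xs :
  ind A ms xs -> (1%:M <= cspan A xs)%MS ->
  #|[set g in unitmx | A *m g == g *m A']| = #|indset A' ms|.
Proof.
move=> xi full; have sx := ind_size xi.
pose X := tcast sx (in_tuple xs).
have eX : X = xs :> seq _ by rewrite val_tcast.
rewrite -(card_in_imset (f := fun g => [tuple of map (mulmx^~ g) X])); last first.
  move=> g h; rewrite !inE => /andP [gu /eqP Ag] /andP [hu /eqP Ah].
  move=> /(congr1 val) /=; rewrite eX => e; apply/row_matrixP => t.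
  have /combP [cs et] : ((delta_mx 0 t : 'rV[F]_n) <= cspan A xs)%MS.
    by apply: submx_trans full; rewrite submx1.
  by rewrite !rowE et -(comb_map _ _ Ag) -(comb_map _ _ Ah) e.
apply: eq_card => t; rewrite inE; apply/imsetP/pboolP => [[g] | ti].
  by rewrite !inE => /andP [gu /eqP Ag] -> /=; rewrite eX; apply: ind_map Ag gu xi.
have [g [gu Ag e]] := ind_similar xi ti full.
by exists g; [rewrite inE gu Ag eqxx | apply: val_inj; rewrite /= eX e].
Qed.

(** Each invertible [g] intertwines [A] with exactly one matrix, its conjugate by [g]. *)
Lemma card_unit_intertwiners A :
  #|[set g : 'M[F]_n | g \in unitmx]| =
  (\sum_(A' : 'M[F]_n) #|[set g in unitmx | A *m g == g *m A']|)%N.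
Proof.
rewrite -sum1dep_card (partition_big (fun g => invmx g *m A *m g) xpredT) //=.
apply: eq_bigr => A' _; rewrite -sum1dep_card; apply: eq_bigl => g.
case gu: (g \in unitmx) => //=; apply/eqP/eqP => [<- | e].
  by rewrite !mulmxA mulmxV // mul1mx.
by rewrite -mulmxA e mulmxA mulVmx // mul1mx.
Qed.

Definition nulclass (nu : {poly F} -> nat) : {set 'M[F]_n} :=
  [set A | pbool (forall p, nullity A p = nu p)].

(** In the sum over [A'], a matrix of the class contributes [typecount], the same for all of them,
    and a matrix outside contributes 0 because similar matrices have equal nullities. *)
Lemma card_nulclass A s xs : divisor_type s -> ind A (ppowers s) xs -> (1%:M <= cspan A xs)%MS ->
  (#|nulclass (nullity A)| * typecount (nullity A) s = #|[set g : 'M[F]_n | g \in unitmx]|)%N.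
Proof.
move=> gs xi full; rewrite (card_unit_intertwiners A) (bigID (mem (nulclass (nullity A)))) /=.
rewrite [X in (_ + X)%N]big1 => [|A' nin].
  rewrite addn0 -sum_nat_const; apply: eq_bigr => A'; rewrite inE => /pboolP eA.
  rewrite (card_intertwiners A' xi full) card_indset //; move: eA; clear.
  by move=> eA; elim: s => //= x s ->; rewrite !eA.
apply/eqP; rewrite cards_eq0; apply: contraNT nin => /set0Pn [g].
rewrite !inE => /andP [gu /eqP Ag]; apply/pboolP => p; exact: similar_nul gu Ag.
Qed.
End Class.

(** The dimension of the kernel of g on the direct sum of the F[X]/(m), as in [rank_kermx_peval]. *)
Definition gcdnul (F : fieldType) (ms : seq {poly F}) (g : {poly F}) : nat :=
  (\sum_(m <- ms) (size (gcdp m g)).-1)%N.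

(** * Realising prescribed nullities by companion matrices *)

Section Companion.
Variable F : finFieldType.
Implicit Types (g : {poly F}) (ms : seq {poly F}).

Lemma peval_block a b (A : 'M[F]_a) (B : 'M[F]_b) g :
  peval (block_mx A 0 0 B) g = block_mx (peval A g) 0 0 (peval B g).
Proof.
elim/poly_ind: g => [|p c IH]; first by rewrite !peval0 block_mx0.
rewrite !pevalD !pevalM !pevalX !pevalC IH mulmx_block scalar_mx_block add_block_mx.
by rewrite !mulmx0 !mul0mx !addr0 !add0r.
Qed.

Lemma nul_block a b (A : 'M[F]_a) (B : 'M[F]_b) g :
  nullity (block_mx A 0 0 B) g = (nullity A g + nullity B g)%N.
Proof.
rewrite /nullity !mxrank_ker peval_block rank_diag_block_mx.
have := rank_leq_row (peval A g); have := rank_leq_row (peval B g); lia.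
Qed.

(** The first unit vector is cyclic with annihilator [m]: its successive images are the other unit
    vectors, so its Krylov matrix is the identity. *)
Lemma nul_companion (m g : {poly F}) : m \is monic ->
  nullity (companionmx m) g = (size (gcdp m g)).-1.
Proof.
move=> mm; have m0 := monic_neq0 mm.
pose y : 'rV[F]_(size m).-1 := \row_j (j == 0 :> nat)%:R.
have K1 : \matrix_(j < (size m).-1) (y *m peval (companionmx m) 'X^j) = 1%:M.
  apply/row_matrixP => -[j lt_j]; rewrite rowK row1 /=.
  elim: j lt_j => [|j IH] lt_j.
    rewrite expr0 peval1 mulmx1; apply/rowP => i; rewrite !mxE eqxx.
    by rewrite -val_eqE eq_sym.
  rewrite exprSr pevalM pevalX mulmxA (IH (ltnW lt_j)).
  by rewrite mulmx_delta_companion.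
have pm : peval (companionmx m) m = 0.
  by have := peval_char_poly (companionmx m); rewrite companionmxK.
rewrite /nullity (@rank_kermx_peval _ _ _ [:: m] [:: y]) /= ?big_seq1 ?m0 //.
  split=> // [|c]; first by rewrite pm mulmx0.
  rewrite submx0 => yc.
  have := yc; rewrite {1}(divp_eq c m) pevalD pevalM pm mulmx0 add0r.
  have szr : (size (c %% m)%R <= (size m).-1)%N.
    by rewrite -ltnS prednK ?lt0n ?size_poly_eq0 // ltn_modp.
  rewrite -(poly_rV_K szr) peval_rVpoly K1 mulmx1 => /eqP r0.
  by rewrite /dvdp -(poly_rV_K szr) r0 linear0.
by rewrite addsmx0 /cyc K1 submx_refl.
Qed.

Lemma exists_gcdnul ms : all (mem monic) ms ->
  exists A : 'M[F]_(\sum_(m <- ms) (size m).-1), nullity A =1 gcdnul ms.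
Proof.
elim: ms => [|m ms IH] /=.
  rewrite big_nil; exists 0 => g; rewrite /nullity /gcdnul big_nil.
  by apply/eqP; rewrite -leqn0 rank_leq_row.
case/andP => mm /IH [A eA]; rewrite big_cons; exists (block_mx (companionmx m) 0 0 A) => g.
by rewrite nul_block nul_companion // eA /gcdnul big_cons.
Qed.

(** A block diagonal of companion matrices has these nullities. A nonzero [typecount] means that it
    admits an independent family of type [s], which generates the space because the degrees add up
    to [n]. *)
Lemma card_gcdnul ms s n : all (mem monic) ms -> divisor_type s ->
  (\sum_(m <- ms) (size m).-1 = n)%N ->
  (\sum_(x <- s) (size (x.1 ^+ x.2)).-1 = n)%N ->
  typecount (gcdnul ms) s != 0%N ->
  (#|nulclass n (gcdnul ms)| * typecount (gcdnul ms) s =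
   #|[set g : 'M[F]_n | g \in unitmx]|)%N.
Proof.
move=> /exists_gcdnul [A eA] gs en; move: A eA; rewrite en => A eA sn nz.
have tc : typecount (gcdnul ms) s = typecount (nullity A) s.
  by move: eA; clear => eA; elim: s => //= x s ->; rewrite !eA.
have nc : nulclass n (gcdnul ms) = nulclass n (nullity A).
  by apply/setP => B; rewrite !inE; apply/pboolP/pboolP => h p; rewrite h eA.
move: nz; rewrite tc nc -card_indset // -lt0n card_gt0 => /set0Pn [xs].
rewrite inE => /pboolP xi; rewrite card_indset //; apply: (card_nulclass gs xi).
rewrite sub1mx /row_full (rank_cspan _ xi) ?big_map ?sn //.
by apply: ppowers_neq0 => x /(divisor_type_in gs) [].
Qed.
End Companion.

(** * Multiplicities of irreducible factors *)

Section Nu.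
Variable F : finFieldType.
Implicit Types (f g : {poly F}).

Lemma dvdp_exp_nu f g e : irreducible_poly f -> g != 0 ->
  (f ^+ e %| g) = (e <= nu f g)%N.
Proof.
move=> irrf g0; have f0 := irredp_neq0 irrf; apply/idP/idP => [fe | le].
  (* The range of the maximum defining [nu] misses no exponent, since f^e has degree at least e. *)
  have lt_e : (e < size g)%N.
    have lee : (e <= (size f).-1 * e)%N.
      by rewrite leq_pmull //; case: (size f) irrf.1 => [|[]].
    rewrite (leq_trans _ (dvdp_leq g0 fe)) //.
    have : (0 < size (f ^+ e))%N by rewrite size_poly_gt0 expf_neq0.
    by case: (size _) (size_exp f e) => //= m -> _; rewrite ltnS.
  exact: (leq_bigmax_cond (F := fun e : 'I_(size g) => e : nat) (Ordinal lt_e)).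
apply: dvdp_trans (dvdp_exp2l _ le) _; rewrite /nu.
by elim/big_ind: _ => // [|a b]; [rewrite expr0 dvd1p | rewrite /maxn; case: ifP].
Qed.

Lemma gcdp_exp_nu f g j : irreducible_poly f -> g != 0 ->
  gcdp g (f ^+ j) %= f ^+ minn (nu f g) j.
Proof.
move=> irrf g0; have f0 := irredp_neq0 irrf; rewrite /eqp dvdp_gcd.
rewrite dvdp_exp_nu // geq_minl (dvdp_exp2l _ (geq_minr _ _)) /= andbT.
have fj0 : f ^+ j != 0 by rewrite expf_neq0.
have gj : gcdp g (f ^+ j) %| f ^+ j by apply: dvdp_gcdr.
have : ~~ (f ^+ (nu f g).+1 %| gcdp g (f ^+ j)).
  by apply/negP => /dvdp_trans/(_ (dvdp_gcdl _ _)); rewrite dvdp_exp_nu // ltnn.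
case/(irreducible_exp_split irrf) => t [c [le_t ec co]].
have c1 : c %= 1.
  (* [c] is coprime to f and divides f^j, so it is coprime to itself, hence a unit. *)
  have: coprimep c c.
    apply: (coprimep_dvdr (_ : c %| f ^+ j)).
      by apply: dvdp_trans gj; rewrite ec dvdp_mulIr.
    exact: coprimep_expl.
  by rewrite coprimepp -size_poly_eq1.
rewrite ec (eqp_dvdl _ (eqp_mull _ c1)) mulr1 dvdp_exp2l // leq_min -ltnS le_t /=.
have : f ^+ t %| f ^+ j by apply: dvdp_trans gj; rewrite ec dvdp_mulIl.
by rewrite dvdp_Pexp2l //; case: irrf.
Qed.

Lemma size_gcdp_exp f g j : irreducible_poly f -> g != 0 ->
  (size (gcdp g (f ^+ j))).-1 = ((size f).-1 * minn (nu f g) j)%N.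
Proof. by move=> irrf g0; rewrite (eqp_size (gcdp_exp_nu _ irrf g0)) size_exp. Qed.

Lemma exists_irreducible_factor g : (1 < size g)%N ->
  exists f, [/\ irreducible_poly f, f \is monic & f %| g].
Proof.
have [N] := ubnP (size g); elim: N g => // N IH g ltN sg.
have g0 : g != 0 by rewrite -size_poly_gt0 (ltnW sg).
have [irr|nirr] := pboolP (irreducible_poly g).
  have l0 : (lead_coef g)^-1 != 0 by rewrite invr_eq0 lead_coef_eq0.
  exists ((lead_coef g)^-1 *: g); split; last by rewrite dvdpZl.
    split=> [|q sq qg]; first by rewrite size_scale.
    rewrite (eqp_rtrans (eqp_scale _ l0)); apply: irr.2 => //.
    by rewrite dvdpZr in qg.
  by rewrite monicE lead_coefZ mulVf // lead_coef_eq0.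
have [q [sq qg nq]] : exists q : {poly F}, [/\ size q != 1%N, q %| g & ~~ (q %= g)].
  case: (pboolP (exists q : {poly F}, [/\ size q != 1%N, q %| g & ~~ (q %= g)])) => // nex.
  case: nirr; split=> // q sq qg; apply/negPn/negP => nq; apply: nex.
  by exists q.
have q0 : q != 0 by apply: contraNneq g0 => e; move: qg; rewrite e dvd0p.
have ltqg : (size q < size g)%N.
  by rewrite ltn_neqAle dvdp_leq // andbT; apply: contra nq; rewrite dvdp_size_eqp.
have [||f [irrf fm fq]] := IH q.
- by rewrite (leq_trans ltqg).
- by move: sq q0; rewrite -size_poly_eq0; case: (size q) => [|[]].
by exists f; split=> //; apply: dvdp_trans qg.
Qed.

(** The product divides [g] because its factors are pairwise coprime; an irreducible factor of the
    cofactor would exceed the valuation of [g]. *)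
Lemma prod_nu (S : seq {poly F}) g : uniq S -> g \is monic ->
  {in S, forall f, irreducible_poly f /\ f \is monic} ->
  (forall f, irreducible_poly f -> f \is monic -> f %| g -> f \in S) ->
  g = \prod_(f <- S) f ^+ nu f g.
Proof.
move=> uS gm SP allS; have g0 := monic_neq0 gm.
pose h := \prod_(f <- S) f ^+ nu f g.
have hm : h \is monic.
  by rewrite /h big_seq; apply: monic_prod => f /SP [_ fm]; apply: monic_exp.
have /dvdpP [c ec] : h %| g.
  rewrite /h; move: uS SP; clear -g0; elim: S => [|f S IH] /=; first by rewrite big_nil dvd1p.
  case/andP=> nf uS SP; have [irrf fm] := SP f (mem_head _ _).
  have {}IH := IH uS (fun x xS => SP x (mem_behead (s := f :: S) xS)).
  rewrite big_cons Gauss_dvdp ?IH ?dvdp_exp_nu ?leqnn //.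
  apply: coprimep_expl; rewrite big_seq; apply: (big_ind (coprimep f)).
  - exact: coprimep1.
  - by move=> x y; rewrite coprimepMr => -> ->.
  move=> x xS; have [|irrx xm] := SP x; first by rewrite inE xS orbT.
  apply: coprimep_expr; apply: irreducible_monic_coprime => //.
  by apply: contraNneq nf => ->.
have c0 : c != 0 by apply: contraNneq g0 => c0; rewrite ec c0 mul0r.
have cm : c \is monic by rewrite -(monicMr c hm) -ec.
have [|lt1] := leqP (size c) 1.
  rewrite leq_eqVlt ltnS size_poly_leq0 (negPf c0) orbF => /size_poly1P [a a0 ea].
  by move: cm ec; rewrite ea monicE lead_coefC => /eqP ->; rewrite mul1r.
have [f [irrf fm fc]] := exists_irreducible_factor lt1.
have fS : f \in S by apply: allS => //; rewrite ec dvdp_mulr.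
suff: f ^+ (nu f g).+1 %| g by rewrite dvdp_exp_nu // ltnn.
by rewrite {2}ec exprS dvdp_mul // /h (big_rem f) //= dvdp_mulr.
Qed.
End Nu.

(** * Products over the parts of a partition *)

Section Parts.
Implicit Types (l : seq nat) (G : nat -> nat -> nat).

Fixpoint tcount G l : nat := if l is a :: l' then (G a (size l') * tcount G l')%N else 1%N.

Lemma conjp_ge l i : (forall x, x \in l -> i <= x)%N -> conjp l i = size l.
Proof. by move=> h; apply/eqP; rewrite -all_count; apply/allP. Qed.

(** In an increasing list, the number of entries after a part equal to i runs once through the
    integers from the count of parts above i up to, but excluding, the count of parts at least i. *)
Lemma tcount_conjp G l N : sorted leq l -> {in l, forall x, 0 < x <= N}%N ->
  tcount G l = (\prod_(1 <= i < N.+1) \prod_(conjp l i.+1 <= t < conjp l i) G i t)%N.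
Proof.
elim: l => [|a l IH] /=; first by rewrite big1 // => i _; rewrite big_geq.
move=> sl lN; have al : {in l, forall x, a <= x}%N.
  by apply/allP; apply: order_path_min sl => // x y z; apply: leq_trans.
have /andP [a0 aN] := lN a (mem_head _ _).
have conjl i : (i <= a)%N -> conjp l i = size l.
  by move=> ia; apply: conjp_ge => x /al; apply: leq_trans.
rewrite IH ?(path_sorted sl) // => [|x xl]; last by apply: lN; rewrite inE xl orbT.
have aI : a \in index_iota 1 N.+1 by rewrite mem_index_iota a0.
rewrite !(bigD1_seq a aI (iota_uniq _ _)) mulnA; congr (_ * _)%N.
  rewrite ltnn leqnn (conjl a (leqnn a)) [(false + _)%N]add0n [(true + _)%N]add1n.
  rewrite big_nat_recr; last exact: count_size.
  by rewrite mulnC.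
apply: eq_bigr => i ia.
case: (ltngtP i a) ia => // lt_ia _.
by rewrite conjl // (conjl i (ltnW lt_ia)) !big_geq.
Qed.

(** Both sides count the cells in the first j columns of the Young diagram, by rows and by
    columns. *)
Lemma sum_minn l j : (\sum_(x <- l) minn x j = hpart l j)%N.
Proof.
rewrite /hpart /conjp; under [RHS]eq_bigr do rewrite -sum1_count big_mkcond.
rewrite exchange_big; apply: eq_bigr => x _ /=.
elim: j => [|j IH]; first by rewrite big_geq // minn0.
by rewrite big_nat_recr //= -IH; case: leqP; lia.
Qed.
End Parts.

Section TypeList.
Variable F : finFieldType.
Implicit Types (f g : {poly F}) (l : seq nat) (s : seq ({poly F} * nat)).
Let q := #|F|.

Definition block f l s := [seq (f, a) | a <- l] ++ s.

Lemma count_block f l s : f \notin [seq x.1 | x <- s] ->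
  count (fun x => x.1 == f) (block f l s) = size l.
Proof.
move=> fs; rewrite /block count_cat count_map (eq_count (a2 := predT)) ?count_predT.
  rewrite (eq_in_count (a2 := pred0)) ?count_pred0 ?addn0 // => x xs /=.
  by apply: contraNF fs => /eqP <-; apply: map_f.
by move=> a /=; rewrite eqxx.
Qed.

Lemma divisor_type_block f l s : irreducible_poly f -> f \is monic ->
  sorted leq l -> {in l, forall a, 0 < a}%N -> f \notin [seq x.1 | x <- s] ->
  divisor_type s -> divisor_type (block f l s).
Proof.
move=> irrf fm sl l0 fs gs; elim: l sl l0 => //= a l IH sl l0.
split=> //; first exact/l0/mem_head.
  move=> y; rewrite mem_cat => /orP [/mapP [b bl ->] _ /= | ys yf].
    have /allP := order_path_min leq_trans sl; exact.
  by case/negP: fs; rewrite -yf map_f.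
by apply: IH; [apply: path_sorted sl | move=> b bl; apply: l0; rewrite inE bl orbT].
Qed.

Lemma typecount_block nu f l s : f \notin [seq x.1 | x <- s] ->
  typecount nu (block f l s) =
  (tcount (fun a t => q ^ nu (f ^+ a) - q ^ (nu (f ^+ a.-1) + (size f).-1 * t))%N l
   * typecount nu s)%N.
Proof.
move=> fs; elim: l => [|a l IH] /=; first by rewrite mul1n.
by rewrite IH -/(block f l s) count_block // mulnA.
Qed.

Lemma q_gt1 : (1 < q)%N. Proof. exact: card_finNzRing_gt1. Qed.

(** Writing the number t of later parts as conjp(i) - j, the exponent h_(i-1) + t becomes h_i - j,
    since h_i = h_(i-1) + conjp(i). *)
Lemma tcount_cf f la (nu : nat -> nat) : (0 < (size f).-1)%N ->
  (forall j, nu j = (size f).-1 * hpart la j)%N ->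
  sorted leq (rev la) -> {in la, forall a, 0 < a}%N ->
  (tcount (fun a t => q ^ nu a - q ^ (nu a.-1 + (size f).-1 * t))%N (rev la))%:R
    = cf q f la :> rat.
Proof.
move=> e0 enu sla la0.
rewrite (@tcount_conjp _ _ (sumn la)) // => [|x]; last first.
  rewrite mem_rev => xl; rewrite la0 //= sumnE (big_rem x) //= leq_addr //.
rewrite /cf natr_prod big_nat [RHS]big_nat; apply: eq_bigr => i /andP [i0 _].
rewrite natr_prod.
have crev j : conjp (rev la) j = conjp la j by rewrite /conjp count_rev.
have le_c : (conjp la i.+1 <= conjp la i)%N.
  by apply: sub_count => x /=; apply: ltnW.
(* Shifting and reversing the inner range makes j run from 1 to m_i. *)
rewrite !crev -{1}[conjp la i.+1]add0n big_addn big_nat_rev /= add0n.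
rewrite big_add1 /= -/(mpart la i) big_nat [RHS]big_nat; apply: eq_bigr => j /= lt_j.
have hi : hpart la i = (hpart la i.-1 + conjp la i)%N.
  by rewrite /hpart -{1}(prednK i0) big_nat_recr ?prednK.
have -> : (nu i.-1 + (size f).-1 * (mpart la i - j.+1 + conjp la i.+1) =
           (size f).-1 * (hpart la i - j.+1))%N.
  rewrite enu -mulnDr hi; congr (_ * _)%N; rewrite /mpart in lt_j *; lia.
rewrite enu natrB ?natrX // leq_exp2l ?q_gt1 // leq_mul2l leq_subr orbT //.
Qed.

(** Every factor is a difference of two distinct powers of q, because 1 <= j <= m_i <= h_i. *)
Lemma cf_neq0 f la : (0 < (size f).-1)%N -> cf q f la != 0.
Proof.
move=> e0; rewrite /cf prodf_seq_neq0; apply/allP => i; rewrite mem_index_iota => /andP [i0 _].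
rewrite prodf_seq_neq0; apply/allP => j; rewrite mem_index_iota => /andP [j0 le_j] /=.
rewrite subr_eq0 -!natrX eqr_nat eqn_exp2l ?q_gt1 // eqn_mul2l negb_or -lt0n e0 /=.
have : (j <= conjp la i)%N.
  by rewrite -ltnS; apply: leq_trans le_j _; rewrite ltnS /mpart leq_subr.
have : hpart la i = (hpart la i.-1 + conjp la i)%N.
  by rewrite /hpart -{1}(prednK i0) big_nat_recr ?prednK.
lia.
Qed.
End TypeList.

Lemma degree_prod (F : fieldType) (I : eqType) (r : seq I) (E : I -> {poly F}) :
  {in r, forall i, E i != 0} ->
  (size (\prod_(i <- r) E i)).-1 = (\sum_(i <- r) (size (E i)).-1)%N.
Proof.
elim: r => [|i r IH] E0; first by rewrite !big_nil size_poly1.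
have E0r : {in r, forall j, E j != 0} by move=> j jr; apply: E0; rewrite inE jr orbT.
have i0 : E i != 0 by apply: E0; apply: mem_head.
have r0 : \prod_(j <- r) E j != 0 by rewrite prodf_seq_neq0; apply/allP => j /E0r.
by rewrite !big_cons size_mul // (polySpred i0) (polySpred r0) /= addnS /= IH.
Qed.

(** * Elementary divisors of a tuple of invariant factors *)

Section ElementaryDivisors.
Variables (F : finFieldType) (k : nat) (p : 'I_k -> {poly F}).
Hypothesis p_monic : forall i, p i \is monic.
Hypothesis p_dvd : forall i j : 'I_k, j = i.+1 :> nat -> p i %| p j.
Let ms := [seq p i | i <- enum 'I_k].

Lemma chain_dvdp (i j : 'I_k) : (i <= j)%N -> p i %| p j.
Proof.
case: j => j lt_j /=; elim: j lt_j => [|j IH] lt_j.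
  by rewrite leqn0 => /eqP i0; rewrite (_ : i = Ordinal lt_j) //; apply: val_inj.
rewrite leq_eqVlt => /predU1P [ij | le_ij]; first by rewrite (_ : i = Ordinal lt_j) //;
  apply: val_inj.
by apply: dvdp_trans (IH (ltnW lt_j) le_ij) _; apply: p_dvd.
Qed.

Lemma Pprod_monic : Pprod p \is monic.
Proof. by apply: monic_prod => i _; apply: p_monic. Qed.

Lemma dvdp_Pprod i : p i %| Pprod p.
Proof. by rewrite /Pprod (bigD1 i) //= dvdp_mulr. Qed.

Lemma mem_Sset f :
  f \in Sset p <-> [/\ irreducible_poly f, f \is monic & f %| Pprod p].
Proof.
rewrite /Sset mem_undup mem_filter; split.
  by case/andP => /and3P [fm /pboolP irrf fP] _.
case=> irrf fm fP; rewrite fm fP andbT; apply/andP; split; first exact/pboolP.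
have szf := dvdp_leq (monic_neq0 Pprod_monic) fP.
apply/mapP; exists [tuple f`_i | i < size (Pprod p)]; first by rewrite mem_enum.
apply/polyP => i; rewrite coef_poly; case: ltnP => [lt_i|le_i].
  by rewrite (nth_map (Ordinal lt_i)) ?size_enum_ord // nth_enum_ord.
by rewrite nth_default // (leq_trans szf).
Qed.

Lemma Phi_gt0 f : {in Phi p f, forall a, 0 < a}%N.
Proof. by move=> a; rewrite mem_filter => /andP []. Qed.

Lemma sorted_Phi f : irreducible_poly f -> sorted leq (rev (Phi p f)).
Proof.
move=> irrf; rewrite /Phi filter_rev revK; apply: sorted_filter; first exact: leq_trans.
rewrite sorted_map; apply: (sub_sorted (e := relpre val ltn)).
  move=> i j /= lt_ij; rewrite -dvdp_exp_nu ?monic_neq0 //.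
  by apply: dvdp_trans (chain_dvdp (ltnW lt_ij)); rewrite dvdp_exp_nu ?monic_neq0.
by rewrite -sorted_map val_enum_ord iota_ltn_sorted.
Qed.

Lemma sum_Phi (G : nat -> nat) f : G 0%N = 0%N ->
  (\sum_(a <- Phi p f) G a = \sum_(i < k) G (nu f (p i)))%N.
Proof.
move=> G0; rewrite big_filter big_rev big_map big_mkcond big_enum /=.
by apply: eq_bigr => i _; case: (nu f (p i)).
Qed.

(** The gcd of p_i and f^j is f to the power min(nu_f(p_i), j); by [sum_minn] these minima add up to
    the h_j of c_f. *)
Lemma gcdnul_exp f j : irreducible_poly f ->
  gcdnul ms (f ^+ j) = ((size f).-1 * hpart (Phi p f) j)%N.
Proof.
move=> irrf; rewrite -sum_minn (sum_Phi (G := minn^~ j)) ?min0n //.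
rewrite /gcdnul big_map big_enum big_distrr /=; apply: eq_bigr => i _.
by rewrite size_gcdp_exp ?monic_neq0.
Qed.

(** Each partition is reversed because [divisor_type] wants increasing exponents. *)
Definition elemdivs S := foldr (fun f => block f (rev (Phi p f))) [::] S.

Lemma elemdivs_notin f S : f \notin S -> f \notin [seq x.1 | x <- elemdivs S].
Proof.
elim: S => //= g S IH; rewrite inE negb_or => /andP [ne nin].
rewrite map_cat mem_cat negb_or IH // andbT -map_comp.
by apply/mapP => -[a _ /= e]; rewrite e eqxx in ne.
Qed.

Lemma divisor_type_elemdivs S : uniq S ->
  {in S, forall f, irreducible_poly f /\ f \is monic} -> divisor_type (elemdivs S).
Proof.
elim: S => //= f S IH /andP [nf uS] SP; have [irrf fm] := SP f (mem_head _ _).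
apply: divisor_type_block => //; first exact: sorted_Phi.
- by move=> a; rewrite mem_rev; apply: Phi_gt0.
- exact: elemdivs_notin.
by apply: IH => // g gS; apply: SP; rewrite inE gS orbT.
Qed.

Lemma typecount_elemdivs S : uniq S ->
  {in S, forall f, irreducible_poly f /\ f \is monic} ->
  (typecount (gcdnul ms) (elemdivs S))%:R = \prod_(f <- S) cf #|F| f (Phi p f) :> rat.
Proof.
elim: S => [|f S IH] /=; first by rewrite big_nil.
move=> /andP [nf uS] SP; have [irrf fm] := SP f (mem_head _ _).
rewrite typecount_block ?elemdivs_notin // natrM big_cons IH //; last first.
  by move=> g gS; apply: SP; rewrite inE gS orbT.
congr (_ * _).
rewrite (@tcount_cf _ f _ (fun a => gcdnul ms (f ^+ a))) //.
- by case: (size f) irrf.1 => [|[]].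
- by move=> j; apply: gcdnul_exp.
- exact: sorted_Phi.
exact: Phi_gt0.
Qed.

Lemma Sset_irr : {in Sset p, forall f, irreducible_poly f /\ f \is monic}.
Proof. by move=> f /mem_Sset []. Qed.

Lemma size_prod_nu i : (size (p i)).-1 = (\sum_(f <- Sset p) (size f).-1 * nu f (p i))%N.
Proof.
rewrite {1}(@prod_nu _ (Sset p) (p i)) ?undup_uniq //; [|exact: Sset_irr|]; last first.
  by move=> f irrf fm fi; apply/mem_Sset; split=> //; apply: dvdp_trans fi (dvdp_Pprod i).
rewrite degree_prod => [|f /Sset_irr [irrf _]]; last by rewrite expf_neq0 ?irredp_neq0.
by apply: eq_bigr => f _; rewrite size_exp.
Qed.

Lemma degree_elemdivs :
  (\sum_(x <- elemdivs (Sset p)) (size (x.1 ^+ x.2)).-1 = \sum_(i < k) (size (p i)).-1)%N.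
Proof.
under [RHS]eq_bigr do rewrite size_prod_nu.
rewrite exchange_big /=.
elim: (Sset p) => [|f S IH] /=; first by rewrite !big_nil.
rewrite big_cat IH big_cons; congr addn.
rewrite big_map big_rev /= -(@sum_Phi (fun a => (size f).-1 * a)%N) ?muln0 //.
by apply: eq_bigr => a _; rewrite size_exp.
Qed.
End ElementaryDivisors.

(** The [typecount] of the elementary divisors is the product of the c_f. Its being nonzero is also
    what gives the independent family behind [card_gcdnul]. *)
Lemma card_gcdnul_cf (F : finFieldType) k (p : 'I_k -> {poly F}) n :
  (forall i, p i \is monic) -> (forall i j : 'I_k, j = i.+1 :> nat -> p i %| p j) ->
  (\sum_(i < k) (size (p i)).-1 = n)%N ->
  #|nulclass n (gcdnul [seq p i | i <- enum 'I_k])|%:R =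
  #|[set g : 'M[F]_n | g \in unitmx]|%:R / \prod_(f <- Sset p) cf #|F| f (Phi p f) :> rat.
Proof.
move=> pm pd pn; have uS : uniq (Sset p) by apply: undup_uniq.
have cf0 : \prod_(f <- Sset p) cf #|F| f (Phi p f) != 0.
  rewrite prodf_seq_neq0; apply/allP => f /(Sset_irr pm) [irrf _] /=.
  by apply: cf_neq0; case: (size f) irrf.1 => [|[]].
have tc := typecount_elemdivs pm pd uS (Sset_irr pm).
apply: (canRL (mulfK cf0)); rewrite -tc -natrM (@card_gcdnul _ _ _ n) //.
- by apply/allP => m /mapP [i _ ->]; apply: pm.
- exact: (divisor_type_elemdivs pm pd uS (Sset_irr pm)).
- by rewrite big_map big_enum.
- by rewrite degree_elemdivs.
by rewrite -(eqr_nat rat) tc.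
Qed.

(** * Minors and determinantal divisors *)

Section Minors.
Variable R : comNzRingType.

(** The index maps are arbitrary, so that minors of a product expand without sorting indices. *)
Definition minor m n i (M : 'M[R]_(m, n)) (r : 'I_i -> 'I_m) (c : 'I_i -> 'I_n) : R :=
  \det (\matrix_(a < i, b < i) M (r a) (c b)).

Lemma minor_tr m n i (M : 'M[R]_(m, n)) (r : 'I_i -> 'I_m) (c : 'I_i -> 'I_n) :
  minor M^T c r = minor M r c.
Proof. by rewrite /minor -det_tr; congr (\det _); apply/matrixP => a b; rewrite !mxE. Qed.

(** Cauchy-Binet before terms are collected: multilinear expansion along the rows. *)
Lemma det_mulmx_rows i m (P : 'M[R]_(i, m)) (M : 'M[R]_(m, i)) :
  \det (P *m M) =
  \sum_(f : {ffun 'I_i -> 'I_m}) (\prod_a P a (f a)) * \det (\matrix_(a, b) M (f a) b).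
Proof.
rewrite /determinant.
transitivity (\sum_(s : 'S_i) \sum_(f : {ffun 'I_i -> 'I_m})
    (-1) ^+ s * \prod_a (P a (f a) * M (f a) (s a))).
  apply: eq_bigr => s _; rewrite -mulr_sumr -(bigA_distr_bigA (fun a j => P a j * M j (s a))).
  by congr (_ * _); apply: eq_bigr => a _; rewrite mxE.
rewrite exchange_big; apply: eq_bigr => f _; rewrite mulr_sumr; apply: eq_bigr => s _.
rewrite big_split /= mulrCA; congr (_ * (_ * _)).
by apply: eq_bigr => a _; rewrite mxE.
Qed.

Lemma minor_mulmx m m' n i (P : 'M[R]_(m', m)) (M : 'M[R]_(m, n)) r c :
  minor (P *m M) r c =
  \sum_(f : {ffun 'I_i -> 'I_m}) (\prod_a P (r a) (f a)) * minor M f c.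
Proof.
have -> : minor (P *m M) r c =
    \det ((\matrix_(a < i, j < m) P (r a) j) *m (\matrix_(j < m, b < i) M j (c b))).
  congr (\det _); apply/matrixP => a b; rewrite !mxE.
  by apply: eq_bigr => j _; rewrite !mxE.
rewrite det_mulmx_rows; apply: eq_bigr => f _; congr (_ * _).
  by apply: eq_bigr => a _; rewrite mxE.
by congr (\det _); apply/matrixP => a b; rewrite !mxE.
Qed.

Lemma sort_injection i n (r : 'I_i -> 'I_n) : injective r ->
  exists (s : 'S_i) (r' : {ffun 'I_i -> 'I_n}), incr r' /\ r =1 r' \o s.
Proof.
move=> r_inj; pose L := sort (relpre val leq) (codom r).
have sL : size L = i by rewrite size_sort size_codom card_ord.
have uL : uniq L by rewrite sort_uniq; apply/injectiveP.
have rL a : (index (r a) L < i)%N by rewrite -[X in (_ < X)%N]sL index_mem mem_sort codom_f.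
have s_inj : injective (fun a => Ordinal (rL a)).
  move=> a b /(congr1 val) /= /(congr1 (nth (r a) L)).
  by rewrite !nth_index ?mem_sort ?codom_f //; apply: r_inj.
exists (perm s_inj), [ffun a => nth (r a) L a]; split=> [|a /=]; last first.
  by rewrite !ffunE permE /= (set_nth_default (r a)) ?nth_index ?sL // mem_sort codom_f.
apply/forallP => a; apply/forallP => b; apply/implyP => lt_ab; rewrite !ffunE.
have sorted_ltn : sorted (relpre val ltn) L.
  suff: sorted ltn (map val L) by rewrite sorted_map.
  rewrite ltn_sorted_uniq_leq map_inj_uniq ?uL /=; last exact: val_inj.
  by rewrite sorted_map; apply: sort_sorted => x y; apply: leq_total.
rewrite (set_nth_default (r b) _ (n := a)) ?sL //.
apply: (sorted_ltn_nth (leT := relpre val ltn)) => //; rewrite ?inE ?sL //.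
by move=> x y z; apply: ltn_trans.
Qed.
End Minors.

Lemma dvdp_sum_all (F : fieldType) I (s : seq I) (P : pred I) (E : I -> {poly F}) (g : {poly F}) :
  (forall i, P i -> g %| E i) -> g %| \sum_(i <- s | P i) E i.
Proof.
move=> h; apply: (big_ind (fun x => g %| x)) => [|x y gx gy|j /h //].
  exact: dvdp0.
by rewrite dvdp_add.
Qed.

Section DetDiv.
Variable F : finFieldType.
Implicit Types (g : {poly F}).

Definition dvd_minors m n (M : 'M[{poly F}]_(m, n)) i g :=
  forall (r : 'I_i -> 'I_m) (c : 'I_i -> 'I_n), g %| minor M r c.

Lemma dvd_minors_tr m n (M : 'M[{poly F}]_(m, n)) i g :
  dvd_minors M^T i g <-> dvd_minors M i g.
Proof. by split=> h r c; [rewrite -minor_tr | rewrite -[M]trmxK minor_tr trmxK]. Qed.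

Lemma dvd_minors_mull m m' n (P : 'M_(m', m)) (M : 'M[{poly F}]_(m, n)) i g :
  dvd_minors M i g -> dvd_minors (P *m M) i g.
Proof.
by move=> h r c; rewrite minor_mulmx; apply: dvdp_sum_all => f _; rewrite dvdp_mull.
Qed.

Lemma dvd_minors_mul m m' n n' (P : 'M_(m', m)) (M : 'M[{poly F}]_(m, n)) (Q : 'M_(n, n')) i g :
  dvd_minors M i g -> dvd_minors (P *m M *m Q) i g.
Proof.
move=> h; apply/dvd_minors_tr; rewrite trmx_mul; apply: dvd_minors_mull.
by apply/dvd_minors_tr; apply: dvd_minors_mull.
Qed.

(** A repeated index gives two equal rows and a zero minor; an injective choice is increasing up to
    a permutation, which only changes the sign. *)
Lemma dvd_minors_incr_rows m n (M : 'M[{poly F}]_(m, n)) i g (c : 'I_i -> 'I_n) :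
  (forall r : {ffun 'I_i -> 'I_m}, incr r -> g %| minor M r c) ->
  forall r : 'I_i -> 'I_m, g %| minor M r c.
Proof.
move=> h r; have [/injectiveP r_inj | /injectivePn [a [b ne e]]] := boolP (injectiveb r).
  have [s [r' [r'_incr er]]] := sort_injection r_inj.
  have -> : minor M r c = (-1) ^+ s * minor M r' c.
    rewrite /minor -det_perm -det_mulmx -row_permE; congr (\det _).
    by apply/matrixP => x y; rewrite !mxE er.
  by rewrite dvdp_mull // h.
rewrite /minor (determinant_alternate ne) ?dvdp0 // => x.
by rewrite !mxE e.
Qed.

Lemma dvd_minors_incr m n (M : 'M[{poly F}]_(m, n)) i g :
  (forall (r : {ffun 'I_i -> 'I_m}) (c : {ffun 'I_i -> 'I_n}), incr r -> incr c ->
     g %| minor M r c) -> dvd_minors M i g.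
Proof.
move=> h r c; apply: dvd_minors_incr_rows => {}r r_incr.
rewrite -minor_tr; apply: dvd_minors_incr_rows => {}c c_incr.
by rewrite minor_tr h.
Qed.

Lemma dvdp_biggcd (I : finType) (P : pred I) (E : I -> {poly F}) g :
  (g %| \big[@gcdp F/0]_(i | P i) E i) <-> (forall i, P i -> g %| E i).
Proof.
split=> [|h]; last first.
  apply: (big_ind (fun x => g %| x)) => // x y gx gy.
  by rewrite dvdp_gcd gx.
move=> h i Pi; have : i \in index_enum I by apply: mem_index_enum.
elim: (index_enum I) h => // j s IH; rewrite big_cons inE.
case: ifP => Pj; first (rewrite dvdp_gcd => /andP [gj /IH {}IH]).
  by case/predU1P => [->|/IH].
by move/IH => {}IH; case/predU1P => [ij|/IH //]; rewrite ij Pj in Pi.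
Qed.

Lemma monicize0 : monicize (0 : {poly F}) = 0. Proof. exact: scaler0. Qed.

Lemma monicize_monic g : g != 0 -> monicize g \is monic.
Proof. by move=> g0; rewrite monicE lead_coefZ mulVf // lead_coef_eq0. Qed.

Lemma monicize_eqp g : monicize g %= g.
Proof.
have [->|g0] := eqVneq g 0; first by rewrite monicize0 eqpxx.
by rewrite eqp_scale // invr_eq0 lead_coef_eq0.
Qed.

Lemma eq_monicize g h : g %= h -> monicize g = monicize h.
Proof.
have [->|g0] := eqVneq g 0; first by rewrite eqp_sym eqp0 => /eqP ->.
move=> gh; have h0 : h != 0 by rewrite -eqp0 -(eqp_ltrans gh) eqp0.
apply/eqP; rewrite -eqp_monic ?monicize_monic //.
by rewrite (eqp_ltrans (monicize_eqp g)) (eqp_rtrans (monicize_eqp h)).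
Qed.

Lemma monicizeM g h : monicize (g * h) = monicize g * monicize h.
Proof. by rewrite /monicize lead_coefM invfM -scalerAr -scalerAl scalerA mulrC. Qed.

Lemma dvdp_detdiv n k (A : 'M[{poly F}]_(n, k)) i g :
  (g %| detdiv A i) <-> dvd_minors A i g.
Proof.
rewrite /detdiv (eqp_dvdr _ (monicize_eqp _)) dvdp_biggcd; split => h.
  by apply: dvd_minors_incr => r c /h/dvdp_biggcd h' /h'.
by move=> r _; apply/dvdp_biggcd => c _; apply: h.
Qed.

Lemma detdiv_monicize n k (A : 'M[{poly F}]_(n, k)) i : monicize (detdiv A i) = detdiv A i.
Proof. exact: eq_monicize (monicize_eqp _). Qed.

Lemma eq_detdiv n k (A : 'M[{poly F}]_(n, k)) i g :
  (forall h, dvd_minors A i h <-> h %| g) -> detdiv A i = monicize g.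
Proof.
move=> h; rewrite -detdiv_monicize; apply: eq_monicize; rewrite /eqp.
by apply/andP; split; [apply/h/dvdp_detdiv | apply/dvdp_detdiv/h].
Qed.

(** The product is the leading minor. Conversely an increasing [r] satisfies j <= r(j), so the
    product divides that of the entries at [r], which factors out of the minor. *)
Lemma dvd_minors_diag k (dd : 'rV[{poly F}]_k) i (le_ik : (i <= k)%N) g :
  (forall j l : 'I_k, (j <= l)%N -> dd 0 j %| dd 0 l) ->
  dvd_minors (diag_mx dd) i g <-> g %| \prod_(j < i) dd 0 (widen_ord le_ik j).
Proof.
move=> dd_chain; split=> [h|h].
  have := h (widen_ord le_ik) (widen_ord le_ik); rewrite /minor.
  rewrite (_ : \matrix_(a, b) _ = diag_mx (\row_j dd 0 (widen_ord le_ik j))).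
    by rewrite det_diag; under eq_bigr do rewrite mxE.
  by apply/matrixP => a b; rewrite !mxE.
apply: dvd_minors_incr => r c r_incr _; apply: dvdp_trans h _.
apply: (@dvdp_trans _ (\prod_(j < i) dd 0 (r j))).
  apply: (big_ind2 (fun x y => x %| y)) => //; first by move=> *; apply: dvdp_mul.
  move=> j _; apply: dd_chain => /=; case: j; elim=> // j IH lt_j.
  apply: leq_ltn_trans (IH (ltnW lt_j)) _.
  by move/forallP/(_ (Ordinal (ltnW lt_j)))/forallP/(_ (Ordinal lt_j))/implyP: r_incr =>
    /(_ (leqnn _)).
rewrite /minor (_ : \matrix_(a, b) _ =
  diag_mx (\row_a dd 0 (r a)) *m \matrix_(a, b) (r a == c b)%:R).
  by rewrite det_mulmx det_diag dvdp_mulr //; under [X in _ %| X]eq_bigr do rewrite mxE.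
apply/matrixP => a b; rewrite mul_diag_mx !mxE mulr_natr; congr (_ *+ _).
Qed.
End DetDiv.

(** * Smith normal form over F[X] *)

Section Smith.
Variable F : fieldType.
Implicit Types (a : {poly F}).

(** Minimality over all equivalent matrices replaces Euclidean elimination: each division step
    becomes a contradiction argument. *)
Definition pivot_minimal k (N : 'M[{poly F}]_k.+1) := forall L R,
  L \in unitmx -> R \in unitmx -> (L *m N *m R) 0 0 != 0 ->
  (size (N 0 0)%R <= size ((L *m N *m R) 0 0)%R)%N.

Lemma pivot_minimal_tr k (N : 'M[{poly F}]_k.+1) : pivot_minimal N -> pivot_minimal N^T.
Proof.
move=> Nmin L R; have -> : L *m N^T *m R = (R^T *m N *m L^T)^T.
  by rewrite !trmx_mul !trmxK mulmxA.
by rewrite ![_^T 0 0]mxE => uL uR; apply: Nmin; rewrite unitmx_tr.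
Qed.

Lemma pivot_minimal_mul k (N L R : 'M[{poly F}]_k.+1) : pivot_minimal N ->
  L \in unitmx -> R \in unitmx -> (L *m N *m R) 0 0 = N 0 0 ->
  pivot_minimal (L *m N *m R).
Proof.
move=> Nmin uL uR e L' R' uL' uR'; rewrite e !mulmxA -mulmxA.
by apply: Nmin; rewrite unitmx_mul ?uL ?uL' ?uR ?uR'.
Qed.

(** Otherwise a column operation followed by a swap would bring the nonzero remainder, of smaller
    degree, into the corner. *)
Lemma pivot_dvd_row k (N : 'M[{poly F}]_k.+1) j : pivot_minimal N -> N 0 0 != 0 ->
  N 0 0 %| N 0 j.
Proof.
move=> Nmin a0; have [-> //|j0] := eqVneq j 0.
set c := N 0 j %/ N 0 0; pose E : 'M[{poly F}]_k.+1 := 1%:M - c *: delta_mx 0 j.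
have uE : E \in unitmx.
  case: (@mulmx1_unit _ _ E (1%:M + c *: delta_mx 0 j)) => //.
  rewrite mulmxBl !mulmxDr !mul1mx mulmx1 -scalemxAl -scalemxAr mul_delta_mx_0 //.
  by rewrite !scaler0 addr0 addrK.
have e : (1%:M *m N *m (E *m tperm_mx 0 j)) 0 0 = N 0 j %% N 0 0.
  rewrite mul1mx mulmxA -xcolE mxE tpermL mulmxBr mulmx1 -scalemxAr !mxE.
  rewrite (bigD1 0) //= big1 => [|l l0]; last by rewrite !mxE (negPf l0) mulr0.
  rewrite !mxE !eqxx mulr1 addr0 {1}(divp_eq (N 0 j) (N 0 0)) -/c.
  by rewrite addrAC subrr add0r.
move: a0; apply: contraLR => ndvd; rewrite -(ltn_modp (N 0 j)) -leqNgt -e.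
by apply: Nmin; rewrite ?unitmx1 ?unitmx_mul ?uE ?unitmx_perm // e.
Qed.

Lemma exists_minimal_pivot k (M : 'M[{poly F}]_k.+1) : M != 0 ->
  exists L R, [/\ L \in unitmx, R \in unitmx, (L *m M *m R) 0 0 != 0 &
    pivot_minimal (L *m M *m R)].
Proof.
move=> M0; pose P n := pbool (exists L R, [/\ L \in unitmx, R \in unitmx,
  (L *m M *m R) 0 0 != 0 & size ((L *m M *m R) 0 0) = n]).
have exP : exists n, P n.
  have [i [j Mij]] : exists i j, M i j != 0.
    have /existsP [i /existsP [j nz]] : [exists i, exists j, M i j != 0].
      apply: contraR M0 => /existsPn h; apply/eqP/matrixP => i j; rewrite mxE.
      by have /existsPn/(_ j)/negPn/eqP := h i.
    by exists i, j.
  eexists; apply/pboolP; exists (tperm_mx 0 i), (tperm_mx 0 j).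
  by split; rewrite ?unitmx_perm // -xcolE -xrowE !mxE !tpermL.
case: (ex_minnP exP) => n /pboolP [L [R [uL uR nz sz]]] nmin.
exists L, R; split=> // L' R' uL' uR' nz'; rewrite sz nmin //; apply/pboolP.
exists (L' *m L), (R *m R'); move: nz'; rewrite !mulmxA => nz'.
by split; rewrite ?unitmx_mul ?uL ?uR ?uL' ?uR'.
Qed.

Lemma pivot_block k (M : 'M[{poly F}]_(1 + k)) : pivot_minimal M -> M 0 0 != 0 ->
  exists L R (M' : 'M_k), [/\ L \in unitmx, R \in unitmx,
    L *m M *m R = block_mx (M 0 0)%:M 0 0 M' & forall i j, M 0 0 %| M' i j].
Proof.
move=> Mmin; set a := M 0 0 => a0.
pose u := \row_j (M 0 (rshift 1 j) %/ a); pose v := \col_i (M (rshift 1 i) 0 %/ a).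
pose L : 'M_(1 + k) := block_mx 1%:M 0 (- v) 1%:M.
pose R : 'M_(1 + k) := block_mx 1%:M (- u) 0 1%:M.
have uL : L \in unitmx by rewrite unitmxE det_lblock !det1 mulr1 unitr1.
have uR : R \in unitmx by rewrite unitmxE det_ublock !det1 mulr1 unitr1.
pose M' := drsubmx M - v *m (a *: u).
have eM : M = block_mx a%:M (a *: u) (a *: v) (drsubmx M).
  rewrite -[LHS]submxK; congr block_mx.
  - by apply/matrixP => i j; rewrite !mxE !ord1 eqxx mulr1n; congr (M _ _); apply: val_inj.
  - apply/rowP => j; rewrite !mxE mulrC divpK; last exact: pivot_dvd_row.
    by congr (M _ _); apply: val_inj.
  - apply/colP => i; rewrite !mxE mulrC divpK; first by congr (M _ _); apply: val_inj.
    by have := pivot_dvd_row (rshift 1 i) (pivot_minimal_tr Mmin); rewrite !mxE; apply.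
have eN : L *m M *m R = block_mx a%:M 0 0 M'.
  rewrite eM !mulmx_block !mul1mx !mulmx1 !mul0mx !mulmx0 !addr0.
  rewrite mulNmx mul_mx_scalar mul_scalar_mx !addNr mulNmx mul0mx add0r addrC.
  by rewrite scalerN addrN [- _ + _]addrC.
exists L, R, M'; split=> // i j.
(* Adding row i of the lower block to the first row keeps the corner, hence its minimality, so
   [pivot_dvd_row] now applies to the entries of [M']. *)
pose S : 'M[{poly F}]_(1 + k) := block_mx 1%:M (delta_mx 0 i) 0 1%:M.
have uS : S \in unitmx by rewrite unitmxE det_ublock !det1 mulr1 unitr1.
have eSN : S *m L *m M *m R = block_mx a%:M (row i M') 0 M'.
  rewrite -!mulmxA [L *m _]mulmxA eN mulmx_block !mul1mx !mul0mx !mulmx0 !addr0 !add0r.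
  by rewrite rowE.
have e0 : (S *m L *m M *m R) 0 0 = a.
  transitivity ((a%:M : 'M[{poly F}]_1) 0 0); last by rewrite mxE.
  rewrite eSN -(block_mxEul a%:M (row i M') 0 M').
  by congr (block_mx _ _ _ _ _ _); apply: val_inj.
have := pivot_dvd_row (rshift 1 j) (pivot_minimal_mul Mmin _ uR e0).
rewrite unitmx_mul uS uL => /(_ isT); rewrite e0 => /(_ a0); rewrite eSN.
suff -> : (block_mx a%:M (row i M') 0 M' : 'M_(1 + k)) 0 (rshift 1 j) = M' i j by [].
transitivity (row i M' 0 j); last by rewrite mxE.
rewrite -(block_mxEur a%:M (row i M') 0 M').
by congr (block_mx _ _ _ _ _ _); apply: val_inj.
Qed.

Theorem smith_normal_form k (M : 'M[{poly F}]_k) :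
  exists L R (dd : 'rV_k), [/\ L \in unitmx, R \in unitmx, L *m M *m R = diag_mx dd &
    forall i j : 'I_k, (i <= j)%N -> dd 0 i %| dd 0 j].
Proof.
elim: k M => [|k IH] M.
  exists 1%:M, 1%:M, 0; rewrite unitmx1; split=> //; last by case.
  by rewrite [LHS]flatmx0 [RHS]flatmx0.
have [->|M0] := eqVneq M 0.
  exists 1%:M, 1%:M, 0; rewrite unitmx1; split=> // [|i j _].
    by rewrite mulmx0 mul0mx linear0.
  by rewrite !mxE.
have [L0 [R0 [uL0 uR0 nz Nmin]]] := exists_minimal_pivot M0.
have [L1 [R1 [M' [uL1 uR1 eN aM']]]] := @pivot_block k _ Nmin nz.
have [L2 [R2 [dd [uL2 uR2 e2 chain]]]] := IH M'.
set a := (L0 *m M *m R0) 0 0 in eN aM'.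
have uB (X : 'M[{poly F}]_k) : X \in unitmx ->
    (block_mx 1%:M 0 0 X : 'M_(1 + k)) \in unitmx.
  by rewrite !unitmxE det_ublock det1 mul1r.
exists ((block_mx 1%:M 0 0 L2 : 'M_(1 + k)) *m (L1 *m L0)), ((R0 *m R1) *m (block_mx 1%:M 0
  0 R2 : 'M_(1 + k))),
  (row_mx a%:M dd : 'rV_(1 + k)); split.
- by rewrite !unitmx_mul uL1 uL0 !andbT; apply: uB.
- by rewrite !unitmx_mul uR1 uR0 /=; apply: uB.
- transitivity ((block_mx 1%:M 0 0 L2 : 'M_(1 + k)) *m block_mx a%:M 0 0 M' *m (block_mx
    1%:M 0 0 R2 : 'M_(1 + k))).
    by rewrite -eN !mulmxA.
  rewrite !mulmx_block !mul1mx !mulmx1 !mul0mx !mulmx0 !addr0 !add0r mul0mx e2.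
  apply: (etrans _ (esym (@diag_mx_row _ _ _ (a%:M : 'rV_1) dd))); congr block_mx;
    apply/matrixP => i j.
  by rewrite !mxE !ord1 eqxx.
have a_dd j : a %| dd 0 j.
  have -> : dd 0 j = (L2 *m M' *m R2) j j by rewrite e2 mxE eqxx.
  rewrite mxE; apply: dvdp_sum_all => l _; apply: dvdp_mulr; rewrite mxE.
  by apply: dvdp_sum_all => l' _; apply: dvdp_mull.
rewrite -[k.+1]/(1 + k)%N => i j; rewrite -(splitK i) -(splitK j).
case: (split i) => i'; case: (split j) => j' /=; rewrite ?row_mxEl ?row_mxEr ?ord1 ?mxE
  ?eqxx ?mulr1n //.
by rewrite leq_add2l; apply: chain.
Qed.
End Smith.

(** * From the Smith form to independent families *)

Section Ev.
Variables (F : fieldType) (d : nat) (A : 'M[F]_d).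
Implicit Types (w v : 'rV[{poly F}]_d) (u : 'rV[F]_d) (c : {poly F}).

(* The F[X]-linear surjection from F[X]^d to F^d with kernel F[X]^d (X - A). *)
Definition ev w : 'rV[F]_d := \sum_l delta_mx 0 l *m peval A (w 0 l).

Lemma evD w v : ev (w + v) = ev w + ev v.
Proof.
rewrite /ev -big_split; apply: eq_bigr => l _ /=.
by rewrite mxE pevalD mulmxDr.
Qed.

Lemma evZ c w : ev (c *: w) = ev w *m peval A c.
Proof.
rewrite /ev mulmx_suml; apply: eq_bigr => l _.
by rewrite mxE mulrC pevalM mulmxA.
Qed.

Lemma ev0 : ev 0 = 0.
Proof. by rewrite -[0 in LHS](scale0r 0) evZ peval0 mulmx0. Qed.

Lemma ev_const u : ev (map_mx polyC u) = u.
Proof.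
rewrite [RHS]row_sum_delta; apply: eq_bigr => l _.
by rewrite mxE pevalC mul_mx_scalar.
Qed.

Lemma ev_mulmx k (w : 'rV[{poly F}]_k) (X : 'M_(k, d)) :
  ev (w *m X) = \sum_j ev (row j X) *m peval A (w 0 j).
Proof.
rewrite mulmx_sum_row (big_morph ev evD ev0); apply: eq_bigr => j _.
by rewrite evZ.
Qed.

Lemma ev_char_poly_mx w : ev (w *m char_poly_mx A) = 0.
Proof.
rewrite ev_mulmx big1 // => j _.
have -> : row j (char_poly_mx A) = 'X *: map_mx polyC (row j 1%:M) + (- 1) *: map_mx polyC
  (row j A).
  by apply/rowP => l; rewrite !mxE mulN1r rmorph_nat mulr_natr.
by rewrite evD !evZ !ev_const pevalX pevalN peval1 mulmxN mulmx1 -row_mul mul1mx subrr mul0mx.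
Qed.

(** Modulo the rows of X - A, multiplying a constant row by X amounts to applying A, so every row is
    congruent to a constant one. In particular the kernel of [ev] is contained in the row module of
    X - A. *)
Lemma ev_modulo w : exists v, w = v *m char_poly_mx A + map_mx polyC (ev w).
Proof.
suff H (l : 'I_d) c : exists v, c *: delta_mx 0 l =
    v *m char_poly_mx A + map_mx polyC (delta_mx 0 l *m peval A c).
  have {H} [V VP] : exists V : 'I_d -> 'rV[{poly F}]_d, forall l, w 0 l *: delta_mx 0 l =
      V l *m char_poly_mx A + map_mx polyC (delta_mx 0 l *m peval A (w 0 l)).
    exists (fun l => projT1 (ClassicalEpsilon.constructive_indefinite_description _ (H l (w
      0 l)))) => l.
    by case: ClassicalEpsilon.constructive_indefinite_description.
  exists (\sum_l V l); rewrite {1}[w]row_sum_delta mulmx_suml /ev.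
  rewrite (raddf_sum (map_mx polyC)) -big_split; apply: eq_bigr => l _ /=.
  exact: VP.
elim/poly_ind: c => [|c a [v IH]].
  by exists 0; rewrite scale0r mul0mx peval0 mulmx0 map_mx0 addr0.
set u := delta_mx 0 l *m peval A c in IH *.
(* Horner step: X u = u (X - A) + u A. *)
exists ('X *: v + map_mx polyC u).
have -> : delta_mx 0 l *m peval A (c * 'X + a%:P) = u *m A + a *: delta_mx 0 l.
  by rewrite pevalD pevalM pevalX pevalC mulmxDr mulmxA mul_mx_scalar.
clearbody u; rewrite mulrC scalerDl -scalerA IH mulmxDl scalerDr -scalemxAl -!addrA; congr (_ + _).
rewrite /char_poly_mx mulmxBr mul_mx_scalar map_mxD map_mxM map_mxZ map_delta_mx.
by rewrite addrA subrK.
Qed.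
End Ev.

Section CombInd.
Variables (F : fieldType) (n : nat) (A : 'M[F]_n).

Lemma comb_big (ys : seq 'rV[F]_n) cs :
  comb A ys cs = \sum_(i < size ys) ys`_i *m peval A (cs i).
Proof.
elim: ys cs => [|y ys IH] cs /=; first by rewrite big_ord0.
by rewrite big_ord_recl IH.
Qed.

Lemma ind_of_comb ms (ys : seq 'rV[F]_n) : size ys = size ms ->
  (forall i, (i < size ms)%N -> ys`_i *m peval A ms`_i = 0) ->
  (forall cs, comb A ys cs = 0 -> forall i, (i < size ms)%N -> ms`_i %| cs i) ->
  ind A ms ys.
Proof.
elim: ms ys => [|m ms IH] [|y ys] //= [sy] ym cy; split; first exact: (ym 0%N).
- move=> c /combP [cs e]; apply: (cy (fun i => if i is j.+1 then cs j * -1 else c) _ 0%N) => //=.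
  by rewrite e comb_peval pevalN peval1 mulmxN mulmx1 subrr.
- apply: IH => // [i lt_i | cs cs0 i lt_i]; first exact: (ym i.+1).
  apply: (cy (fun i => if i is j.+1 then cs j else 0) _ i.+1) => //=.
  by rewrite peval0 mulmx0 add0r.
Qed.
End CombInd.

Section SmithNul.
Variables (F : fieldType) (d m : nat) (A : 'M[F]_d).
Let N : 'M[{poly F}]_(d + m) := block_mx (char_poly_mx A) 0 0 1%:M.

(** The rows of [invmx Q] are a basis of F[X]^(d+m) in which the row module of [N] becomes diagonal.
    The identity block kills the last m coordinates, so the generators are the images under [ev] of
    the first d columns. *)
Lemma smith_ind (L Q : 'M_(d + m)) dd :
  L \in unitmx -> Q \in unitmx -> L *m N *m Q = diag_mx dd ->
  exists2 ys, ind A [seq dd 0 i | i <- enum 'I_(d + m)] ys & (1%:M <= cspan A ys)%MS.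
Proof.
move=> uL uQ eD; pose Y := lsubmx (invmx Q).
pose ys := [seq ev A (row i Y) | i <- enum 'I_(d + m)].
have combE cs : comb A ys cs = ev A ((\row_i cs i) *m Y).
  rewrite comb_big ev_mulmx size_map size_enum_ord; apply: eq_bigr => i _.
  by rewrite (nth_map i) ?size_enum_ord // nth_ord_enum mxE.
have eDL : N *m Q = invmx L *m diag_mx dd by rewrite -eD -mulmxA mulKmx.
exists ys; last first.
  apply/rV_subP => u _; apply/combP.
  pose c := row_mx (map_mx polyC u) 0 *m Q.
  exists (fun i => if insub i is Some j then c 0 j else 0).
  rewrite combE -[LHS](ev_const A); congr (ev A _).
  have -> : \row_(i < d + m) (if insub (val i) is Some j then c 0 j else 0) = c.
    by apply/rowP => i; rewrite mxE valK.
  by rewrite /Y mulmx_lsub /c mulmxK // row_mxKl.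
have sz (T : Type) (E : 'I_(d + m) -> T) : size [seq E i | i <- enum 'I_(d + m)] = (d + m)%N.
  by rewrite size_map size_enum_ord.
have nthE (T : Type) (x0 : T) (E : 'I_(d + m) -> T) i (lt_i : (i < d + m)%N) :
    nth x0 [seq E i | i <- enum 'I_(d + m)] i = E (Ordinal lt_i).
  rewrite (nth_map (Ordinal lt_i)) ?size_enum_ord //.
  by rewrite (nth_ord_enum _ (Ordinal lt_i)).
have szM := sz _ (fun i => dd 0 i); apply: ind_of_comb; rewrite ?szM ?sz //.
  move=> i lt_i; rewrite (nthE _ _ _ _ lt_i) (nthE _ _ (fun i => dd 0 i) _ lt_i).
  rewrite -evZ; set j := Ordinal lt_i.
  have -> : dd 0 j *: row j Y = lsubmx (row j L) *m char_poly_mx A.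
    transitivity (row j (diag_mx dd *m Y)); first by rewrite row_mul row_diag_mx -scalemxAl -rowE.
    rewrite -eD /Y mulmx_lsub mulmxK //.
    transitivity (lsubmx (row j L *m N)); first by rewrite -row_mul; apply/rowP => l; rewrite !mxE.
    by rewrite -{1}[row j L]hsubmxK mul_row_block row_mxKl mulmx0 addr0.
  exact: ev_char_poly_mx.
move=> cs; rewrite combE; set c := \row_i cs i => e i lt_i.
have [v] := ev_modulo A (c *m Y); rewrite e map_mx0 addr0 => ev_c.
(* A relation lifts to a combination of the rows of [N]: the first block of coefficients is [v], the
   second is read off through the identity block. *)
have ec : c = row_mx v (rsubmx (c *m invmx Q)) *m invmx L *m diag_mx dd.
  rewrite -mulmxA -eDL !mulmxA -[LHS](mulmxKV uQ); congr (_ *m _).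
  rewrite mul_row_block !mulmx0 mulmx1 addr0 add0r -ev_c /Y.
  by rewrite mulmx_lsub hsubmxK.
have -> : cs i = c 0 (Ordinal lt_i) by rewrite mxE.
rewrite (nthE _ _ _ _ lt_i) ec mul_mx_diag mxE.
by rewrite dvdp_mull.
Qed.
End SmithNul.

(** Differences of [hpart] give the conjugate partition, whose differences give the multiplicities;
    equality of sizes settles the entries 0. *)
Lemma sorted_hpart_inj (l l' : seq nat) : sorted leq l -> sorted leq l' ->
  size l = size l' -> (forall j, hpart l j = hpart l' j) -> l = l'.
Proof.
move=> sl sl' sz h; apply: (sorted_eq leq_trans anti_leq) => //.
have hpartS s j : hpart s j.+1 = (hpart s j + conjp s j.+1)%N.
  by rewrite /hpart big_nat_recr.
have conjE j : conjp l j = conjp l' j.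
  case: j => [|j]; first by rewrite !conjp_ge.
  by have := h j.+1; rewrite !hpartS h => /addnI.
apply/allP => v _ /=; apply/eqP.
have countE s : (count_mem v s + conjp s v.+1)%N = conjp s v.
  rewrite /conjp; elim: s => //= a s <-.
  by rewrite addnACA; congr addn; case: (ltngtP v a).
by have := countE l; rewrite !conjE -(countE l') => /addIn.
Qed.

(** * Invariant factors and nullities *)

Section Link.
Variables (F : finFieldType).

(** The values at the powers of f determine the valuations at f as a multiset, and the divisibility
    chain fixes their order; monic polynomials are then recovered by [prod_nu]. *)
Lemma gcdnul_inj k (p p' : 'I_k -> {poly F}) :
  (forall i, p i \is monic) -> (forall i j : 'I_k, j = i.+1 :> nat -> p i %| p j) ->
  (forall i, p' i \is monic) -> (forall i j : 'I_k, j = i.+1 :> nat -> p' i %| p' j) ->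
  gcdnul [seq p i | i <- enum 'I_k] =1 gcdnul [seq p' i | i <- enum 'I_k] -> p =1 p'.
Proof.
move=> pm pd pm' pd' e.
have nuE f : irreducible_poly f -> forall i, nu f (p i) = nu f (p' i).
  move=> irrf i.
  have sorted_nu (s : 'I_k -> {poly F}) : (forall i, s i \is monic) ->
      (forall i j : 'I_k, j = i.+1 :> nat -> s i %| s j) ->
      sorted leq [seq nu f (s i) | i <- enum 'I_k].
    move=> sm sd; rewrite sorted_map; apply: (sub_sorted (e := relpre val ltn)).
      move=> a b /= lt_ab; rewrite -dvdp_exp_nu ?monic_neq0 //.
      by apply: dvdp_trans (chain_dvdp sd (ltnW lt_ab)); rewrite dvdp_exp_nu ?monic_neq0.
    by rewrite -sorted_map val_enum_ord iota_ltn_sorted.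
  have gcdnulE (s : 'I_k -> {poly F}) j : (forall i, s i \is monic) ->
      gcdnul [seq s i | i <- enum 'I_k] (f ^+ j) =
      ((size f).-1 * hpart [seq nu f (s i) | i <- enum 'I_k] j)%N.
    move=> sm; rewrite -sum_minn /gcdnul !big_map big_distrr /=; apply: eq_bigr => a _.
    by rewrite size_gcdp_exp ?monic_neq0.
  have e0 : (0 < (size f).-1)%N by case: (size f) irrf.1 => [|[]].
  have := @sorted_hpart_inj _ _ (sorted_nu _ pm pd) (sorted_nu _ pm' pd').
  rewrite !size_map => /(_ erefl) H.
  have /eq_in_map H' : [seq nu f (p i) | i <- enum 'I_k] = [seq nu f (p' i) | i <- enum 'I_k].
    by apply: H => j; apply/eqP; rewrite -(eqn_pmul2l e0) -!gcdnulE // e.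
  by apply: H'; rewrite mem_enum.
move=> i; pose S := undup (Sset p ++ Sset p').
have SP : {in S, forall f, irreducible_poly f /\ f \is monic}.
  by move=> f; rewrite mem_undup mem_cat => /orP [] /mem_Sset [].
rewrite (@prod_nu _ S (p i)) ?undup_uniq // => [|f irrf fm fp]; last first.
  rewrite mem_undup mem_cat; apply/orP; left; apply/mem_Sset => //.
  by split=> //; apply: dvdp_trans fp (dvdp_Pprod _ _).
rewrite [RHS](@prod_nu _ S (p' i)) ?undup_uniq // => [|f irrf fm fp]; last first.
  rewrite mem_undup mem_cat; apply/orP; right; apply/mem_Sset => //.
  by split=> //; apply: dvdp_trans fp (dvdp_Pprod _ _).
by rewrite !big_seq; apply: eq_bigr => f /SP [irrf _]; rewrite nuE.
Qed.

Lemma inv_factor_smith n k (B : 'M[F]_(n, k)) (dd : 'rV_k) :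
  (forall i, dd 0 i != 0) -> (forall i j : 'I_k, (i <= j)%N -> dd 0 i %| dd 0 j) ->
  (forall i g, dvd_minors (charmx B) i g <-> dvd_minors (diag_mx dd) i g) ->
  forall i, inv_factor B i = monicize (dd 0 i).
Proof.
move=> dd0 chain same i.
have detE j (le_jk : (j <= k)%N) :
    detdiv (charmx B) j = monicize (\prod_(l < j) dd 0 (widen_ord le_jk l)).
  apply: eq_detdiv => g; apply: iff_trans (same j g) _; exact: dvd_minors_diag.
rewrite /inv_factor (detE _ (ltn_ord i)) (detE _ (ltnW (ltn_ord i))) big_ord_recr /=.
have -> : widen_ord (ltn_ord i) ord_max = i by apply: val_inj.
have -> : \prod_(l < i) dd 0 (widen_ord (ltn_ord i) (widen_ord (leqnSn i) l)) =
    \prod_(l < i) dd 0 (widen_ord (ltnW (ltn_ord i)) l).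
  by apply: eq_bigr => l _; congr (dd 0 _); apply: val_inj.
rewrite monicizeM mulKp // monic_neq0 // monicize_monic //.
by apply/prodf_neq0 => l _.
Qed.

(** One Smith form of diag(X - A, 1) yields both the invariant factors of [B], through minors, and
    the nullities of [A], through [smith_ind]. The converse direction is [gcdnul_inj]. *)
Lemma inv_factor_nulclass n d m (B : 'M[F]_(n, d + m)) (A : 'M[F]_d)
    (p : 'I_(d + m) -> {poly F}) :
  (forall i g, dvd_minors (charmx B) i g <->
     dvd_minors (block_mx (char_poly_mx A) 0 0 1%:M : 'M_(d + m)) i g) ->
  (forall i, p i \is monic) -> (forall i j : 'I_(d + m), j = i.+1 :> nat -> p i %| p j) ->
  [forall i, inv_factor B i == p i] =
  (A \in nulclass d (gcdnul [seq p i | i <- enum 'I_(d + m)])).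
Proof.
set N := block_mx _ _ _ _ => same pm pd.
have [L [R [dd [uL uR eD chain]]]] := smith_normal_form N.
have dd0 i : dd 0 i != 0.
  have det0 (X : 'M[{poly F}]_(d + m)) : X \in unitmx -> \det X != 0.
    by rewrite unitmxE; apply: contraTneq => ->; rewrite unitr0.
  have : \det (diag_mx dd) != 0.
    rewrite -eD !det_mulmx !mulf_neq0 ?(det0 L) ?(det0 R) //.
    by rewrite /N det_ublock det1 mulr1 monic_neq0 // char_poly_monic.
  by rewrite det_diag => /prodf_neq0; apply.
have same' i g : dvd_minors (charmx B) i g <-> dvd_minors (diag_mx dd) i g.
  apply: iff_trans (same i g) _; split=> [h|h].
    by rewrite -eD; apply: dvd_minors_mul.
  have -> : N = invmx L *m diag_mx dd *m invmx R by rewrite -eD -mulmxA mulmxK // mulKmx.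
  exact: dvd_minors_mul.
have invE := inv_factor_smith dd0 chain same'.
have [ys yi full] := smith_ind uL uR eD.
pose p' i := monicize (dd 0 i).
have nulE g : nullity A g = gcdnul [seq p' i | i <- enum 'I_(d + m)] g.
  rewrite /nullity (rank_kermx_peval g _ yi full); last first.
    by apply/allP => x /mapP [i _ ->]; apply: dd0.
  rewrite /gcdnul !big_map; apply: eq_bigr => i _.
  by rewrite (eqp_size (eqp_gcdl _ (monicize_eqp _))).
have pm' i : p' i \is monic by apply: monicize_monic.
have pd' (i j : 'I_(d + m)) : j = i.+1 :> nat -> p' i %| p' j.
  move=> ij; rewrite /p' (eqp_dvdl _ (monicize_eqp _)) (eqp_dvdr _ (monicize_eqp _)).
  by apply: chain; rewrite ij leqW.
rewrite inE; apply/forallP/pboolP => [h g|h i].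
  rewrite nulE; congr (gcdnul _ g); apply: eq_map => i.
  by rewrite /p' -invE; apply/eqP.
by rewrite invE; apply/eqP; apply: (gcdnul_inj pm' pd' pm pd) => g; rewrite -nulE.
Qed.
End Link.

(** * Pairs of matrices and their invariant subspaces *)

Section Pairs.
Variable F : finFieldType.

Definition pair_inv k r (C : 'M[F]_k) (D : 'M[F]_(k, r)) p (X : 'M_(p, k)) :=
  (X *m C <= X)%MS && (X *m D == 0).

Definition maxinv k r (CD : 'M[F]_k * 'M[F]_(k, r)) (U : 'M_k) :=
  pair_inv CD.1 CD.2 U && [forall X : 'M_k, pair_inv CD.1 CD.2 X ==> (X <= U)%MS].

(** The control-theoretic notion: the unobservable subspace is zero. *)
Definition observable k r (CD : 'M[F]_k * 'M[F]_(k, r)) := maxinv CD 0.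

Lemma eq_pair_inv k r (C : 'M[F]_k) (D : 'M[F]_(k, r)) p p' (X : 'M_(p, k)) (Y : 'M_(p', k)) :
  (X :=: Y)%MS -> pair_inv C D X = pair_inv C D Y.
Proof.
move=> e; rewrite /pair_inv (eqmxMr C e) e; congr (_ && _).
by rewrite -!submx0 (eqmxMr D e).
Qed.

Lemma maxinvP k r (CD : 'M[F]_k * 'M[F]_(k, r)) U :
  reflect (pair_inv CD.1 CD.2 U /\ forall p (X : 'M_(p, k)), pair_inv CD.1 CD.2 X -> (X <= U)%MS)
          (maxinv CD U).
Proof.
apply: (iffP andP) => -[iU maxU]; split=> //.
  move=> p X iX; rewrite -(genmxE X); apply: (implyP (forallP maxU _)).
  by rewrite (eq_pair_inv _ _ (genmxE X)).
by apply/forallP => X; apply/implyP/maxU.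
Qed.

Lemma eq_maxinv k r (CD : 'M[F]_k * 'M[F]_(k, r)) (U V : 'M_k) :
  (U :=: V)%MS -> maxinv CD U = maxinv CD V.
Proof.
move=> e; rewrite /maxinv (eq_pair_inv _ _ e); congr (_ && _).
by apply: eq_forallb => X; rewrite e.
Qed.

Lemma maxinv_uniq k r (CD : 'M[F]_k * 'M[F]_(k, r)) (U V : 'M_k) :
  maxinv CD U -> maxinv CD V -> (U :=: V)%MS.
Proof.
move=> /maxinvP [iU mU] /maxinvP [iV mV]; apply/eqmxP.
by rewrite mU // mV.
Qed.

Lemma exists_maxinv k r (CD : 'M[F]_k * 'M[F]_(k, r)) : exists U, maxinv CD U.
Proof.
exists (\sum_(X : 'M_k | pair_inv CD.1 CD.2 X) X)%MS; apply/maxinvP; split; last first.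
  move=> p X iX; rewrite -(genmxE X); apply: (sumsmx_sup <<X>>%MS) => //.
  by rewrite (eq_pair_inv _ _ (genmxE X)).
apply/andP; split.
  rewrite sumsmxMr; apply/sumsmx_subP => X /[dup] iX /andP [XC _].
  exact: (sumsmx_sup X).
rewrite -submx0 sumsmxMr_gen; apply/sumsmx_subP => X /andP [_ /eqP ->].
by rewrite genmx0.
Qed.

Definition conjpair k r (g : 'M[F]_k) (CD : 'M[F]_k * 'M[F]_(k, r)) :=
  (invmx g *m CD.1 *m g, invmx g *m CD.2).

Lemma pair_inv_conj k r (g : 'M[F]_k) (CD : 'M[F]_k * 'M[F]_(k, r)) p (X : 'M_(p, k)) :
  g \in unitmx ->
  pair_inv (conjpair g CD).1 (conjpair g CD).2 (X *m g) = pair_inv CD.1 CD.2 X.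
Proof.
move=> ug; rewrite /pair_inv /conjpair /= !mulmxA !mulmxK //; congr (_ && _).
by rewrite submxMfree // row_free_unit.
Qed.

Lemma maxinv_conj k r (g : 'M[F]_k) (CD : 'M[F]_k * 'M[F]_(k, r)) U :
  g \in unitmx -> maxinv (conjpair g CD) (U *m g) = maxinv CD U.
Proof.
move=> ug; apply/maxinvP/maxinvP => -[]; rewrite pair_inv_conj // => iU mU; split=> // p X iX.
  by rewrite -(submxMfree _ _ (_ : row_free g)) ?row_free_unit //; apply: mU; rewrite pair_inv_conj.
have eX : X = X *m invmx g *m g by rewrite mulmxKV.
rewrite eX submxMfree ?row_free_unit //; apply: mU.
by rewrite -(pair_inv_conj _ _ ug) -eX.
Qed.

Lemma conjpair_inj k r (g : 'M[F]_k) : g \in unitmx -> injective (@conjpair k r g).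
Proof.
move=> ug [C D] [C' D'] [/(congr1 (mulmx g)) e1 /(congr1 (mulmx g)) e2].
move: e1 e2; rewrite -!mulmxA !(mulKVmx ug) => e1 ->; congr (_, _).
by apply: (can_inj (mulmxK ug)).
Qed.

Lemma conjpairK k r (g : 'M[F]_k) : g \in unitmx ->
  cancel (@conjpair k r (invmx g)) (conjpair g).
Proof.
by move=> ug [C D]; rewrite /conjpair /= invmxK !mulmxA mulVmx // !mul1mx mulmxKV.
Qed.

Lemma card_maxinv_conj k r (g U : 'M[F]_k) (Psi : pred ('M[F]_k * 'M[F]_(k, r))) :
  g \in unitmx -> (forall CD, Psi (conjpair g CD) = Psi CD) ->
  #|[set CD | maxinv CD (U *m g) && Psi CD]| = #|[set CD | maxinv CD U && Psi CD]|.
Proof.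
move=> ug invPsi; rewrite -[RHS](card_imset _ (conjpair_inj ug)).
apply: eq_card => CD; rewrite inE; apply/idP/imsetP => [h|[CD' + ->]].
  exists (conjpair (invmx g) CD); last by rewrite conjpairK.
  by rewrite inE -(maxinv_conj _ _ ug) -invPsi conjpairK.
by rewrite inE maxinv_conj // invPsi.
Qed.

(** Once the span of the first d coordinates is invariant, the invariant subspaces containing it
    correspond to those of the quotient pair, and maximality says that the latter are zero. *)
Lemma maxinv_pid d m r (C : 'M[F]_(d + m)) (D : 'M_(d + m, r)) :
  maxinv (C, D) (pid_mx d) =
  [&& ursubmx C == 0, usubmx D == 0 & observable (drsubmx C, dsubmx D)].
Proof.
rewrite pid_mx_block.
have U0E p (X1 : 'M[F]_(p, d)) (X2 : 'M_(p, m)) :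
    (row_mx X1 X2 <= block_mx 1%:M 0 0 (0 : 'M[F]_m))%MS = (X2 == 0).
  apply/submxP/eqP => [[Y]|->].
    by rewrite -[Y]hsubmxK mul_row_block !mulmx0 !addr0 => /eq_row_mx [_ ->].
  by exists (row_mx X1 0); rewrite mul_row_block !mulmx0 mulmx1 !addr0.
have eC := submxK C; have eD := vsubmxK D.
move: (ulsubmx C) (ursubmx C) (dlsubmx C) (drsubmx C) eC => A B E C' <-.
move: (usubmx D) (dsubmx D) eD => D1 D' <-.
have iU0 : pair_inv (block_mx A B E C') (col_mx D1 D') (block_mx 1%:M 0 0 (0 : 'M[F]_m)) =
    (B == 0) && (D1 == 0).
  rewrite /pair_inv mulmx_block !mul1mx !mul0mx !addr0 mul_block_col !mul1mx !mul0mx !addr0.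
  rewrite block_mxEv -addsmxE addsmx_sub !U0E eqxx andbT; congr (_ && _).
  by rewrite col_mx_eq0 eqxx andbT.
apply/maxinvP/and3P => /=; rewrite iU0.
  case=> /andP [/eqP B0 /eqP D10] maxU; rewrite B0 D10 !eqxx; split=> //.
  apply/maxinvP; rewrite /pair_inv /= !mul0mx sub0mx eqxx; split=> // p X /andP [XC /eqP XD].
  (* The preimage of [X] under the projection onto the last m coordinates. *)
  have iX : pair_inv (block_mx A B E C') (col_mx D1 D') (block_mx 1%:M 0 0 X).
    rewrite /pair_inv B0 D10 mulmx_block mul_block_col !mul1mx !mul0mx ?mulmx0 !addr0 !add0r XD.
    rewrite col_mx0 eqxx andbT [block_mx A _ _ _]block_mxEv -addsmxE addsmx_sub.
    have [Y ->] := submxP XC; apply/andP; split; apply/submxP.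
      by exists (row_mx A 0); rewrite mul_row_block !mulmx0 mulmx1 mul0mx !addr0.
    by exists (row_mx (X *m E) Y); rewrite mul_row_block !mulmx0 mulmx1 addr0 add0r.
  have := maxU _ _ iX; rewrite [X in (X <= _)%MS]block_mxEv -addsmxE addsmx_sub.
  by rewrite !U0E => /andP [_ /eqP ->]; rewrite sub0mx.
case=> /eqP -> /eqP -> /maxinvP [_ obs]; rewrite !eqxx; split=> // p X.
rewrite -[X]hsubmxK; move: (lsubmx X) (rsubmx X) => X1 X2.
rewrite /pair_inv mul_row_block mul_row_col !mulmx0 !add0r => /andP [/submxP [Y]].
rewrite mul_mx_row => /eq_row_mx [_ X2C] X2D; rewrite U0E -submx0; apply: (obs _ X2).
by rewrite /pair_inv X2D X2C submxMl.
Qed.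
End Pairs.

(** * Classifying pairs by their maximal invariant subspace *)

Section CountPairs.
Variable F : finFieldType.
Let q := #|F|.

Definition nobs k r := #|[set CD : 'M[F]_k * 'M[F]_(k, r) | observable CD]|.

Lemma card_maxinv_pid d m r (Q : pred 'M[F]_d) :
  #|[set CD : 'M[F]_(d + m) * 'M_(d + m, r) | maxinv CD (pid_mx d) && Q (ulsubmx CD.1)]| =
  (#|[set A | Q A]| * q ^ (m * d) * nobs m r)%N.
Proof.
pose f (x : 'M[F]_d * ('M[F]_(m, d) * ('M[F]_m * 'M[F]_(m, r)))) :=
  (block_mx x.1 0 x.2.1 x.2.2.1, col_mx (0 : 'M_(d, r)) x.2.2.2).
have f_inj : injective f.
  move=> [A [E [C D]]] [A' [E' [C' D']]] [/eq_block_mx [-> _ -> ->]].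
  by move=> /eq_col_mx [_ ->].
rewrite -card_mx -mulnA -cardsT -!cardsX -[RHS](card_imset _ f_inj).
apply: eq_card => -[C D]; rewrite inE maxinv_pid /=; apply/idP/imsetP => [|[[A [E [C' D']]]]].
  case/andP => /and3P [/eqP C0 /eqP D0 obs] QA.
  exists (ulsubmx C, (dlsubmx C, (drsubmx C, dsubmx D))); first by rewrite !inE /= QA.
  by rewrite /f /= -C0 submxK -D0 vsubmxK.
rewrite !inE /= => /andP [QA obs] [-> ->].
by rewrite block_mxKur block_mxKul block_mxKdr col_mxKu col_mxKd !eqxx obs.
Qed.

(** Used twice: with a trivial [Psi] for the recursion on observable pairs, and with prescribed
    invariant factors for the final count. *)
Lemma card_maxinv_psi d m r (U : 'M[F]_(d + m)) (Q : pred 'M[F]_d)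
    (Psi : pred ('M[F]_(d + m) * 'M[F]_(d + m, r))) :
  \rank U = d -> (forall g CD, g \in unitmx -> Psi (conjpair g CD) = Psi CD) ->
  (forall CD, maxinv CD (pid_mx d) -> Psi CD = Q (ulsubmx CD.1)) ->
  #|[set CD | maxinv CD U && Psi CD]| = (#|[set A | Q A]| * q ^ (m * d) * nobs m r)%N.
Proof.
move=> rU conjPsi PsiQ; rewrite -card_maxinv_pid.
have eU : (U :=: (pid_mx d : 'M_(d + m)) *m row_ebase U)%MS.
  have {1}-> : U = col_ebase U *m (pid_mx d *m row_ebase U) by rewrite -[X in pid_mx X]rU
    mulmxA mulmx_ebase.
  apply: eqmxMfull; by rewrite row_full_unit col_ebase_unit.
transitivity #|[set CD | maxinv CD (pid_mx d *m row_ebase U) && Psi CD]|.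
  by apply: eq_card => CD; rewrite !inE (eq_maxinv _ eU).
rewrite card_maxinv_conj ?row_ebase_unit // => [|CD]; last by rewrite conjPsi ?row_ebase_unit.
by apply: eq_card => CD; rewrite !inE; apply: andb_id2l => /PsiQ.
Qed.

Lemma card_maxinv k r (U : 'M[F]_k) :
  #|[set CD : 'M[F]_k * 'M[F]_(k, r) | maxinv CD U]| =
  (q ^ (\rank U * \rank U) * q ^ ((k - \rank U) * \rank U) * nobs (k - \rank U) r)%N.
Proof.
have := rank_leq_row U; have := erefl (\rank U); move: {1 3 4 5 6 7 8}(\rank U) => d rU le_dk.
pose m := (k - d)%N; have ek : k = (d + m)%N by rewrite subnKC.
rewrite -/m; clearbody m; subst k.
transitivity #|[set CD : 'M[F]_(d + m) * 'M[F]_(d + m, r) | maxinv CD U && xpredT CD]|.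
  by apply: eq_card => CD; rewrite !inE andbT.
rewrite (@card_maxinv_psi _ _ _ _ xpredT) //; congr (_ * _ * _)%N.
by rewrite -card_mx; apply: eq_card => A; rewrite inE.
Qed.

(** Fixed points of [genmx] are canonical representatives, so each subspace counts once. *)
Definition nsub k d := #|[set U : 'M[F]_k | (<<U>>%MS == U) && (\rank U == d)]|.

Lemma sum_nsub k (G : nat -> nat) :
  (\sum_(U : 'M[F]_k | <<U>>%MS == U) G (\rank U) = \sum_(d < k.+1) nsub k d * G d)%N.
Proof.
rewrite (partition_big (fun U : 'M[F]_k => inord (\rank U) : 'I_k.+1) xpredT) //=.
apply: eq_bigr => d _; rewrite /nsub -sum_nat_const; apply: eq_big => [U|U].
  by rewrite inE; congr (_ && _); rewrite -val_eqE /= inordK // ltnS rank_leq_row.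
by case/andP => _ /eqP <-; rewrite inordK // ltnS rank_leq_row.
Qed.

(** Every pair has exactly one maximal invariant subspace; the right side is the number of all
    pairs. *)
Lemma sum_card_maxinv k r :
  (\sum_(d < k.+1) nsub k d * (q ^ (d * d) * q ^ ((k - d) * d) * nobs (k - d) r) =
   q ^ (k * (k + r)))%N.
Proof.
rewrite -(sum_nsub k (fun d => q ^ (d * d) * q ^ ((k - d) * d) * nobs (k - d) r))%N.
transitivity #|{: 'M[F]_k * 'M[F]_(k, r)}|; last by rewrite card_prod !card_mx mulnDr expnD.
rewrite -sum1_card.
have [U UP] := fin_all_exists (@exists_maxinv F k r).
rewrite (partition_big (fun CD => <<U CD>>%MS) (fun V => <<V>>%MS == V)) => [|CD _]; last first.
  by rewrite /= genmx_id.
apply: eq_bigr => V /eqP eV; rewrite -card_maxinv -sum1dep_card; apply: eq_bigl => CD.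
apply/idP/eqP => [mV | <-]; last by rewrite (eq_maxinv _ (genmxE _)).
by rewrite -eV; apply/eq_genmx/(maxinv_uniq (UP CD) mV).
Qed.
End CountPairs.

(** * Counting subspaces *)

Section Grassmann.
Variable F : finFieldType.
Let q := #|F|.

Definition nfree d k := #|[set X : 'M[F]_(d, k) | row_free X]|.

Lemma nfreeS d k : nfree d.+1 k = ((q ^ k - q ^ d) * nfree d k)%N.
Proof.
rewrite /nfree -(card_fibers (Q := fun (x : 'rV[F]_k) X => ~~ (x <= X)%MS)); last first.
  move=> X rX; have cX : #|rowg X| = (q ^ d)%N by rewrite card_rowg (eqP rX).
  rewrite -[X in _ = (q ^ X - _)%N](mul1n k) -card_mx -cX -cardsT -cardsDS ?subsetT //;
    apply: eq_card => x.
  by rewrite !inE andbT.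
pose f (p : 'rV[F]_k * 'M[F]_(d, k)) : 'M_(1 + d, k) := col_mx p.1 p.2.
have f_inj : injective f by move=> [x X] [y Y] /eq_col_mx /= [-> ->].
rewrite -[RHS](card_imset _ f_inj); apply: eq_card => X.
have eX : X = f (usubmx (X : 'M_(1 + d, k)), dsubmx (X : 'M_(1 + d, k))) by rewrite /f /= vsubmxK.
rewrite eX inE mem_imset // inE /=; move: (usubmx _) (dsubmx _) => {eX}x Y.
rewrite /f /row_free /= (_ : \rank _ = \rank (x + Y)%MS); last by rewrite addsmxE.
have := mxrank_sum_cap x Y; have [xY _ | nxY] := boolP (x <= Y)%MS.
  by rewrite andbF (addsmx_idPr xY); apply: contraTF (rank_leq_row Y) => /eqP ->; rewrite ltnn.
have -> : (x :&: Y = 0)%MS.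
  apply/eqP; apply: contraNT nxY; rewrite -mxrank_eq0 -lt0n => rcap.
  have [_ /esym e] := mxrank_leqif_sup (capmxSl x Y).
  have : (x <= x :&: Y)%MS by rewrite e eqn_leq mxrankS ?capmxSl // (leq_trans
    (rank_leq_row _) rcap).
  by rewrite sub_capmx => /andP [].
have x0 : x != 0 by apply: contraNneq nxY => ->; apply: sub0mx.
by rewrite mxrank0 addn0 rank_rV x0 andbT => ->; rewrite add1n eqSS.
Qed.

Lemma nfree_unit d : nfree d d = #|[set g : 'M[F]_d | g \in unitmx]|.
Proof. by apply: eq_card => g; rewrite !inE row_free_unit. Qed.

(** A free matrix is an ordered basis of its row space, and GL_d acts simply transitively on the
    bases of one subspace. *)
Lemma nfree_nsub d k : nfree d k = (nsub F k d * nfree d d)%N.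
Proof.
rewrite nfree_unit {1}/nfree -sum1dep_card.
rewrite (partition_big (fun X : 'M[F]_(d, k) => <<X>>%MS)
  (fun U => U \in [set U : 'M[F]_k | (<<U>>%MS == U) && (\rank U == d)])) => [|X rX]; last first.
  by rewrite inE genmx_id eqxx /= mxrank_gen.
rewrite /nsub -sum_nat_const; apply: eq_bigr => U; rewrite inE => /andP [/eqP eU /eqP rU].
have [Y rY eY] : exists2 Y : 'M[F]_(d, k), row_free Y & (Y :=: U)%MS.
  by move: rU => <-; exists (row_base U); [apply: row_base_free | apply: eq_row_base].
have f_inj : injective (fun g : 'M[F]_d => g *m Y) by apply: row_free_inj.
rewrite sum1dep_card -[RHS](card_imset _ f_inj); apply: eq_card => X; rewrite inE.
apply/andP/imsetP => [[rX /eqP eX]|[g]].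
  have eXY : (X == Y)%MS.
    by apply/eqmxP; apply: eqmx_trans (eqmx_sym eY); rewrite -eX; apply/eqmx_sym/genmxE.
  have /submxP [g eg] : (X <= Y)%MS by case/andP: eXY.
  exists g => //; rewrite inE -row_free_unit /row_free -(mxrankMfree _ rY) -eg; exact: rX.
rewrite inE => ug ->; rewrite /row_free (mxrankMfree _ rY) mxrank_unit // eqxx; split=> //.
by rewrite -eU; apply/eqP/eq_genmx; apply: eqmx_trans eY; apply: eqmxMfull; rewrite row_full_unit.
Qed.
End Grassmann.

(** * The number of observable pairs *)

Section QIdentity.
Variables (K : fieldType) (q : K).
Hypothesis q0 : q != 0.
Hypothesis q_pow : forall n, q ^+ n.+1 != 1.

Definition qfall d x := \prod_(i < d) (x - q ^+ i).
(** The Gaussian binomial coefficient. *)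
Definition qbin k d := qfall d (q ^+ k) / qfall d (q ^+ d).

Lemma qfallS d x : qfall d.+1 x = qfall d x * (x - q ^+ d).
Proof. by rewrite /qfall big_ord_recr. Qed.

Lemma qfall_mulq d x : qfall d.+1 (q * x) = (q * x - 1) * q ^+ d * qfall d x.
Proof.
rewrite /qfall big_ord_recl expr0 -mulrA; congr (_ * _).
rewrite -[X in q ^+ X]card_ord -prodr_const -big_split; apply: eq_bigr => i _ /=.
by rewrite exprS mulrBr.
Qed.

Lemma qfall_neq0 d : qfall d (q ^+ d) != 0.
Proof.
elim: d => [|d IH]; first by rewrite /qfall big_ord0 oner_eq0.
by rewrite exprS qfall_mulq -exprS !mulf_neq0 ?expf_neq0 // subr_eq0.
Qed.

Lemma qbin0 k : qbin k 0 = 1.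
Proof. by rewrite /qbin /qfall !big_ord0 divr1. Qed.

Lemma qbin_small k : qbin k k.+1 = 0.
Proof. by rewrite /qbin qfallS subrr mulr0 mul0r. Qed.

Lemma qbin_pascal k e : (e <= k)%N ->
  qbin k.+1 e.+1 = qbin k e.+1 + q ^+ (k - e) * qbin k e.
Proof.
move=> le_ek; rewrite /qbin !exprS !qfall_mulq qfallS.
have ek : q ^+ k = q ^+ e * q ^+ (k - e) by rewrite -exprD subnKC.
have := qfall_neq0 e; have : q * q ^+ e - 1 != 0 by rewrite -exprS subr_eq0.
have : q ^+ e != 0 by rewrite expf_neq0.
rewrite ek; move: (q ^+ (k - e)) (q ^+ e) (qfall e (q ^+ e)) (qfall e (q ^+ e * _)) => v u
  b a u0 w0 b0.
by field; rewrite b0 u0 w0.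
Qed.

(** By the q-Pascal rule the sum for k + 1 splits into (x - q^(k+1)) x^k and q^(k+1) x^k; the second
    part is the identity for k taken at x / q. *)
Lemma qbin_sum k x :
  \sum_(d < k.+1) qbin k d * q ^+ (d * d) * \prod_(d.+1 <= i < k.+1) (x - q ^+ i) = x ^+ k.
Proof.
elim: k x => [|k IH] x.
  by rewrite big_ord1 qbin0 big_geq // !mulr1.
pose T d := q ^+ (d * d) * \prod_(d.+1 <= i < k.+2) (x - q ^+ i).
have -> : \sum_(d < k.+2) qbin k.+1 d * q ^+ (d * d) * \prod_(d.+1 <= i < k.+2) (x - q ^+ i)
   = \sum_(d < k.+2) qbin k d * T d + \sum_(e < k.+1) q ^+ (k - e) * qbin k e * T e.+1.
  rewrite big_ord_recl [in RHS]big_ord_recl !qbin0 -addrA mulrA; congr (_ + _).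
  rewrite -big_split; apply: eq_bigr => e _ /=; rewrite qbin_pascal ?mulrDl -?mulrA //.
  by rewrite -ltnS.
have -> : \sum_(d < k.+2) qbin k d * T d = (x - q ^+ k.+1) * x ^+ k.
  rewrite big_ord_recr /= qbin_small mul0r addr0 -IH big_distrr /=.
  apply: eq_bigr => d _; rewrite /T big_nat_recr ?ltnS //=; last by rewrite -ltnS.
  by ring.
have -> : \sum_(e < k.+1) q ^+ (k - e) * qbin k e * T e.+1 = q ^+ k.+1 * x ^+ k.
  have -> : q ^+ k.+1 * x ^+ k = q ^+ (k + k).+1 * (x / q) ^+ k.
    by rewrite exprMn exprVn -addnS exprD; field; rewrite expf_neq0.
  rewrite -IH big_distrr; apply: eq_bigr => e _ /=.
  have le_ek : (e <= k)%N by rewrite -ltnS.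
  have -> : T e.+1 = q ^+ (e.+1 * e.+1) * (q ^+ (k - e) * \prod_(e.+1 <= i < k.+1) (x / q -
    q ^+ i)).
    rewrite /T big_add1 /=; congr (_ * _).
    have -> : (k - e = k.+1 - e.+1)%N by rewrite subSS.
    rewrite -prodr_const_nat -big_split; apply: eq_bigr => i _ /=.
    by rewrite mulrBr mulrCA divff // mulr1 exprS.
  have -> : q ^+ (k + k).+1 = q ^+ (k - e) * q ^+ (k - e) * q ^+ (e + e).+1.
    by rewrite -!exprD; congr (_ ^+ _); lia.
  have -> : q ^+ (e.+1 * e.+1) = q ^+ (e * e) * q ^+ (e + e).+1.
    by rewrite -!exprD; congr (_ ^+ _); lia.
  by ring.
by rewrite -mulrDl subrK exprS.
Qed.
End QIdentity.

Section Observable.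
Variable F : finFieldType.
Let q : rat := #|F|%:R.

Lemma card_gt0_rat : q != 0.
Proof. by rewrite pnatr_eq0 -lt0n (ltn_trans _ (card_finNzRing_gt1 F)). Qed.

Lemma card_pow_neq1 n : q ^+ n.+1 != 1.
Proof.
rewrite -natrX -[1]/(1%:R) eqr_nat -(expn0 #|F|) eqn_exp2l //.
exact: card_finNzRing_gt1.
Qed.

Lemma nfreeE d k : (d <= k)%N -> (nfree F d k)%:R = qfall q d (q ^+ k).
Proof.
elim: d => [_|d IH lt_dk].
  rewrite /qfall big_ord0 /nfree (_ : [set _ | _] = setT) ?cardsT ?card_mx ?mul0n //.
  by apply/setP => X; rewrite !inE /row_free flatmx0 mxrank0.
rewrite nfreeS natrM IH ?(ltnW lt_dk) // natrB ?leq_exp2l ?card_finNzRing_gt1 ?(ltnW lt_dk) //.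
by rewrite !natrX qfallS mulrC.
Qed.

Lemma nsubE d k : (d <= k)%N -> (nsub F k d)%:R = qbin q k d.
Proof.
move=> le_dk; rewrite /qbin -nfreeE // -nfreeE // [in RHS]nfree_nsub natrM mulfK //.
by rewrite nfreeE // qfall_neq0 //; [apply: card_gt0_rat | apply: card_pow_neq1].
Qed.

(** Each of the m factors absorbs q^d; this merges the choices of the free block [E] with the
    observable pairs. *)
Lemma shift_prod d m x :
  q ^+ (m * d) * \prod_(1 <= i < m.+1) (x - q ^+ i) =
  \prod_(d.+1 <= i < (d + m).+1) (x * q ^+ d - q ^+ i).
Proof.
elim: m => [|m IH]; first by rewrite addn0 !big_geq // mulr1.
rewrite addnS [RHS]big_nat_recr ?ltnS ?leq_addr //= -IH big_nat_recr //= mulSn exprD.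
by rewrite -addnS exprD; ring.
Qed.

(** At x = q^(k+r), [qbin_sum] has the same total as [sum_card_maxinv]. The terms with d > 0 agree
    by induction, so the terms with d = 0 agree as well. *)
Theorem nobsE k r :
  (nobs F k r)%:R = \prod_(1 <= i < k.+1) (q ^+ (k + r) - q ^+ i).
Proof.
elim/ltn_ind: k r => k IH r.
have sumN := congr1 (fun n => n%:R : rat) (sum_card_maxinv F k r).
have := qbin_sum card_gt0_rat card_pow_neq1 k (q ^+ (k + r)).
have -> : (q ^+ (k + r)) ^+ k = (#|F| ^ (k * (k + r)))%:R by rewrite natrX -exprM mulnC.
rewrite -sumN natr_sum !big_ord_recl /= qbin0.
have tail e : (e < k)%N ->
    (nsub F k e.+1 * (#|F| ^ (e.+1 * e.+1) * #|F| ^ ((k - e.+1) * e.+1) * nobs F (k - e.+1) r))%:R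
    = qbin q k e.+1 * q ^+ (e.+1 * e.+1) * \prod_(e.+2 <= i < k.+1) (q ^+ (k + r) - q ^+ i).
  move=> lt_ek; rewrite !natrM !natrX nsubE // IH; last by rewrite -subSn // subSS leq_subr.
  rewrite -!mulrA; congr (_ * (_ * _)); rewrite shift_prod subnKC // -exprD.
  by rewrite addnAC subnK.
rewrite [X in _ + X = _](eq_bigr _ (fun e _ => esym (tail _ (ltn_ord e)))).
move/addIr; rewrite !mul0n muln0 !expn0 expr0 !mul1r mul1n => ->.
have -> : nsub F k 0 = 1%N by apply/eqP; rewrite -(eqr_nat rat) nsubE // qbin0.
by rewrite subn0 !mul1n.
Qed.
End Observable.

(** * The pair of matrices attached to T *)

Section PairMatrix.
Variable F : finFieldType.

Definition pairmx k r (CD : 'M[F]_k * 'M[F]_(k, r)) : 'M[F]_(k + r, k) :=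
  (row_mx CD.1 CD.2)^T.

Definition pairchar k r (CD : 'M[F]_k * 'M[F]_(k, r)) : 'M[{poly F}]_(k, k + r) :=
  row_mx (char_poly_mx CD.1) (- map_mx polyC CD.2).

Lemma Imx_tr (R : pzRingType) k r : (Imx R (k + r) k)^T = row_mx 1%:M 0.
Proof.
apply/matrixP => i j; rewrite !mxE; case: splitP => l ->; rewrite !mxE.
  by rewrite eq_sym -val_eqE; case: eqP.
by case: eqP (ltn_ord i) => // <-; rewrite ltnNge leq_addr.
Qed.

Lemma charmx_pair k r (CD : 'M[F]_k * 'M[F]_(k, r)) : (charmx (pairmx CD))^T = pairchar CD.
Proof.
rewrite /charmx /pairmx linearB /= linearZ /= Imx_tr map_trmx trmxK map_row_mx.
by rewrite scale_row_mx opp_row_mx add_row_mx scaler0 add0r scale_scalar_mx mulr1.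
Qed.

Lemma T_invariant_pair k r (CD : 'M[F]_k * 'M[F]_(k, r)) (X : 'M_k) :
  T_invariant (pairmx CD) X = pair_inv CD.1 CD.2 X.
Proof.
rewrite /T_invariant /pairmx trmxK Imx_tr !mul_mx_row mulmx1 mulmx0 /pair_inv.
apply/submxP/andP => [[Y]|[/submxP [Y ->] /eqP ->]].
  by rewrite mul_mx_row mulmx0 => /eq_row_mx [-> ->]; rewrite submxMl.
by exists Y; rewrite mul_mx_row mulmx0.
Qed.

Lemma is_max_inv_pair k r (CD : 'M[F]_k * 'M[F]_(k, r)) U :
  is_max_inv (pairmx CD) U = maxinv CD U.
Proof.
rewrite /is_max_inv /maxinv T_invariant_pair; congr (_ && _).
by apply: eq_forallb => X; rewrite T_invariant_pair.
Qed.

Lemma pairmx_inj k r : injective (@pairmx k r).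
Proof. by move=> [C D] [C' D'] /trmx_inj /eq_row_mx /= [-> ->]. Qed.

Lemma card_pairmx k r (P : pred 'M[F]_(k + r, k)) :
  #|[set B | P B]| = #|[set CD : 'M[F]_k * 'M[F]_(k, r) | P (pairmx CD)]|.
Proof.
rewrite -[RHS](card_imset _ (@pairmx_inj k r)); apply: eq_card => B; rewrite inE.
apply/idP/imsetP => [PB|[CD + ->]]; last by rewrite inE.
have eB : B = pairmx (lsubmx B^T, rsubmx B^T) by rewrite /pairmx /= hsubmxK trmxK.
by exists (lsubmx B^T, rsubmx B^T); rewrite // inE -eB.
Qed.

Lemma dvd_minors_pairchar k r (CD : 'M[F]_k * 'M[F]_(k, r)) i g :
  dvd_minors (charmx (pairmx CD)) i g <-> dvd_minors (pairchar CD) i g.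
Proof. by rewrite -charmx_pair; apply: iff_sym; apply: dvd_minors_tr. Qed.

Lemma eq_inv_factor n k (B B' : 'M[F]_(n, k)) :
  (forall i g, dvd_minors (charmx B) i g <-> dvd_minors (charmx B') i g) ->
  inv_factor B =1 inv_factor B'.
Proof.
move=> same i; have e j : detdiv (charmx B) j = detdiv (charmx B') j.
  rewrite -[RHS]detdiv_monicize; apply: eq_detdiv => g.
  by apply: iff_trans (same j g) _; apply: iff_sym; apply: dvdp_detdiv.
by rewrite /inv_factor !e.
Qed.

Lemma pairchar_conj k r g (CD : 'M[F]_k * 'M[F]_(k, r)) : g \in unitmx ->
  pairchar (conjpair g CD) = map_mx polyC (invmx g) *m pairchar CD *m
    block_mx (map_mx polyC g) 0 0 1%:M.
Proof.
move=> ug; rewrite /pairchar mul_mx_row mul_row_block !mulmx0 addr0 add0r mulmx1.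
rewrite /= mulmxN -map_mxM; congr (row_mx _ _).
rewrite /char_poly_mx mulmxBr mulmxBl -!map_mxM mul_mx_scalar -scalemxAl -map_mxM mulVmx //.
by rewrite map_mx1 scale_scalar_mx mulr1.
Qed.

Lemma inv_factor_conj k r g (CD : 'M[F]_k * 'M[F]_(k, r)) : g \in unitmx ->
  inv_factor (pairmx (conjpair g CD)) =1 inv_factor (pairmx CD).
Proof.
move=> ug; have sub h (CD' : 'M[F]_k * 'M[F]_(k, r)) : h \in unitmx -> forall i x,
    dvd_minors (pairchar CD') i x -> dvd_minors (pairchar (conjpair h CD')) i x.
  by move=> uh i x; rewrite pairchar_conj //; apply: dvd_minors_mul.
apply: eq_inv_factor => i x; rewrite !dvd_minors_pairchar; split; last exact: sub.
have ug' : invmx g \in unitmx by rewrite unitmx_inv.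
by move/(sub _ _ ug'); rewrite -{2}[g]invmxK conjpairK.
Qed.

(** Duality of observability and controllability: the orthogonal of the [C^T]-module generated by
    the columns of [D] is invariant for the pair, hence zero. *)
Lemma observable_full m r (C : 'M[F]_m) (D : 'M[F]_(m, r)) : observable (C, D) ->
  (1%:M <= cspan C^T [seq row i D^T | i <- enum 'I_r])%MS.
Proof.
move/maxinvP => [_ obs]; set Z := cspan _ _.
have DZ : (D^T <= Z)%MS.
  apply/row_subP => i; rewrite /Z; elim: (enum 'I_r) (mem_enum 'I_r i) => // j s IH.
  rewrite !inE /= => /orP [/eqP <-|/IH h]; last exact: submx_trans h (addsmxSr _ _).
  apply: submx_trans (addsmxSl _ _); apply/cycP; exists 1.
  by rewrite peval1 mulmx1.
have CZ : (Z *m C^T <= Z)%MS.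
  by apply/row_subP => i; rewrite row_mul -{1}(pevalX C^T); apply/cspan_peval/row_sub.
have : (kermx Z^T <= (0 : 'M_m))%MS.
  apply: obs; rewrite /pair_inv /=; have [Y eY] := submxP CZ; have [Y' eY'] := submxP DZ.
  rewrite sub_kermx -mulmxA -[C]trmxK -trmx_mul eY trmx_mul mulmxA mulmx_ker mul0mx eqxx.
  by rewrite -[D]trmxK eY' trmx_mul mulmxA mulmx_ker mul0mx eqxx.
rewrite submx0 kermx_eq0 -row_leq_rank mxrank_tr => rZ.
by rewrite sub1mx /row_full eqn_leq rank_leq_row.
Qed.

(** By [observable_full] and [ev_modulo], each unit row is a polynomial combination of the columns
    of [D] modulo X - [C^T]; transposing gives the right inverse. *)
Lemma observable_right_inverse m r (C : 'M[F]_m) (D : 'M[F]_(m, r)) : observable (C, D) ->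
  exists S1 S2, char_poly_mx C *m S1 - map_mx polyC D *m S2 = 1%:M.
Proof.
move/observable_full => full.
have [vc vcP] : exists vc : 'I_m -> 'rV[{poly F}]_m * 'rV[{poly F}]_r, forall l,
    (vc l).1 *m char_poly_mx C^T - (vc l).2 *m map_mx polyC D^T = delta_mx 0 l.
  apply: (@fin_all_exists _ (fun=> _)
    (fun l (vc : 'rV[{poly F}]_m * 'rV[{poly F}]_r) =>
       vc.1 *m char_poly_mx C^T - vc.2 *m map_mx polyC D^T = delta_mx 0 l)) => l.
  have /combP [cs ecs] : ((delta_mx 0 l : 'rV[F]_m) <= cspan C^T [seq row i D^T | i <- enum
    'I_r])%MS.
    by apply: submx_trans full; rewrite submx1.
  pose c := \row_(i < r) cs i.
  have [v ev_c] := ev_modulo C^T (c *m map_mx polyC D^T).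
  have e : ev C^T (c *m map_mx polyC D^T) = delta_mx 0 l.
    rewrite ecs comb_big ev_mulmx size_map size_enum_ord; apply: eq_bigr => i _.
    rewrite (nth_map i) ?size_enum_ord // nth_ord_enum mxE.
    by rewrite -map_row ev_const.
  exists (- v, - c) => /=.
  by rewrite !mulNmx opprK ev_c e addKr map_delta_mx.
exists (\matrix_l (vc l).1)^T, (\matrix_l (vc l).2)^T.
have etr : (char_poly_mx C)^T = char_poly_mx C^T.
  by rewrite /char_poly_mx linearB /= tr_scalar_mx map_trmx.
apply: trmx_inj; rewrite linearB /= !trmx_mul !trmxK trmx1 etr map_trmx.
by apply/row_matrixP => l; rewrite linearB /= !row_mul !rowK row1 vcP.
Qed.

(** Each of the two matrices is a right multiple of the other, so their minors have the same common
    divisors. *)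
Lemma dvd_minors_block d m r (C : 'M[F]_(d + m)) (D : 'M[F]_(d + m, r)) i g :
  maxinv (C, D) (pid_mx d) ->
  dvd_minors (pairchar (C, D)) i g <->
  dvd_minors (block_mx (char_poly_mx (ulsubmx C)) 0 0 1%:M : 'M_(d + m)) i g.
Proof.
rewrite maxinv_pid => /and3P [/eqP C0 /eqP D0 /observable_right_inverse [S1 [S2 eS]]].
pose A := ulsubmx C; pose E := map_mx polyC (dlsubmx C).
pose C' := drsubmx C; pose D' := map_mx polyC (dsubmx D).
rewrite -/C' -/D' in eS.
have eM : pairchar (C, D) = row_mx (block_mx (char_poly_mx A) 0 (- E) (char_poly_mx C'))
   (col_mx 0 (- D')).
  rewrite /pairchar /= -{1}[C]submxK -[D in LHS]vsubmxK C0 D0 map_col_mx map_mx0 opp_col_mx oppr0.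
  congr row_mx; rewrite /char_poly_mx map_block_mx map_mx0 scalar_mx_block opp_block_mx
    add_block_mx.
  by rewrite !sub0r oppr0.
set N := block_mx _ _ _ _.
have eMN : pairchar (C, D) = 1%:M *m N *m row_mx (block_mx 1%:M 0 (- E) (char_poly_mx C'))
  (col_mx 0 (- D')).
  rewrite eM mul1mx mul_mx_row mulmx_block mul_block_col.
  by rewrite !mulmx0 !mul0mx !mulmx1 !mul1mx !addr0 !add0r.
(* The right inverse produces the identity block; applied to [E], it also cancels the lower left
   block. *)
have eNM : N = 1%:M *m pairchar (C, D) *m
    col_mx (block_mx 1%:M 0 (S1 *m E) S1) (row_mx (S2 *m E) S2).
  rewrite eM mul1mx mul_row_col mulmx_block mul_col_row add_block_mx.
  rewrite !mulmx0 !mul0mx !mulmx1 !addr0 add0r !mulmxA !mulNmx eS.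
  by rewrite -addrA -mulmxBl eS mul1mx addNr.
by split=> h; [rewrite eNM | rewrite eMN]; apply: dvd_minors_mul.
Qed.

Lemma GLcardE d : GLcard F d = #|[set g : 'M[F]_d | g \in unitmx]|.
Proof.
case: d => [|d] /=.
  rewrite (_ : [set _ | _] = setT) ?cardsT ?card_mx ?mul0n //.
  by apply/setP => g; rewrite !inE [g]flatmx0 unitmxE det_mx00 unitr1.
by rewrite cardsT card_sub cardsE; apply: eq_card => g.
Qed.
End PairMatrix.

Theorem theorem3 (F : finFieldType) (n k d : nat) (hk : (0 < k)%N) (hkn : (k <= n)%N)
    (U : 'M[F]_k) (hU : \rank U = d)
    (p : 'I_k -> {poly F})
    (hmonic : forall i, p i \is monic)
    (hdvd : forall i j : 'I_k, j = i.+1 :> nat -> p i %| p j)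
    (hdeg : (size (\prod_(i < k) p i)).-1 = d) :
  let q := #|F| in
  (#|[set B : 'M[F]_(n, k) | is_max_inv B U && [forall i, inv_factor B i == p i]]|%:R : rat)
  = (GLcard F d)%:R / (\prod_(f <- Sset p) cf q f (Phi p f))
    * \prod_(d.+1 <= i < k.+1) ((q%:R : rat) ^+ n - (q%:R : rat) ^+ i).
Proof.
move=> q; have le_dk : (d <= k)%N by rewrite -hU rank_leq_row.
have ek : k = (d + (k - d))%N by rewrite subnKC.
have en : n = (k + (n - k))%N by rewrite subnKC.
move: (n - k)%N (k - d)%N en ek => r m en ek; subst n; clear hkn; subst k.
(* From here k = d + m and n = d + m + r; the prescribed invariant factors become the condition [Q]
   on the restriction of T to U. *)
pose Q : pred 'M[F]_d := mem (nulclass d (gcdnul [seq p i | i <- enum 'I_(d + m)])).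
rewrite (card_pairmx (fun B => is_max_inv B U && [forall i, inv_factor B i == p i])).
transitivity (#|[set CD : 'M[F]_(d + m) * 'M[F]_(d + m, r) |
    maxinv CD U && [forall i, inv_factor (pairmx CD) i == p i]]|%:R : rat).
  by congr (_%:R); apply: eq_card => CD; rewrite !inE is_max_inv_pair.
rewrite (@card_maxinv_psi _ _ _ _ _ Q) //; first last.
- move=> [C D] UCD; apply: inv_factor_nulclass => // i g.
  by apply: iff_trans (dvd_minors_pairchar _ _ _) _; apply: dvd_minors_block.
- by move=> g CD ug; apply: eq_forallb => i; rewrite inv_factor_conj.
have -> : #|[set A | Q A]| = #|nulclass d (gcdnul [seq p i | i <- enum 'I_(d + m)])|.
  by apply: eq_card => A; rewrite inE.
rewrite !natrM natrX (card_gcdnul_cf hmonic hdvd); last first.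
  by rewrite -[RHS]hdeg degree_prod // => i _; apply: monic_neq0.
(* The remaining factor q^(md) times the number of observable pairs is the product over d < i <= k,
   as q^(m+r) q^d = q^n. *)
rewrite GLcardE nobsE -mulrA shift_prod; congr (_ * _).
by apply: eq_bigr => i _; rewrite -exprD (_ : m + r + d = d + m + r)%N //; lia.
Qed.
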